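(* Let $(M^{2m},g,J^M)$ be a $(1,2)$-symplectic manifold and $N^{2n}$ an oriented even-dimensional Riemannian manifold. Let $\psi:M^{2m}\to\Sigma^+N^{2n}$ be a $(J^M,\mathcal{J}^2)$-holomorphic map. Then the projected map $\varphi=\pi\circ\psi:M^{2m}\to N^{2n}$ is (weakly) pluriconformal and $(1,1)$-geodesic.
   Context: An almost Hermitian manifold $(M,g,J)$ is $(1,2)$-symplectic if $\nabla_{Z^{01}}Y^{10}\in\Gamma(T^{10}M)$ for all $Z^{01}\in\Gamma(T^{01}M)$, $Y^{10}\in\Gamma(T^{10}M)$, $\nabla$ the Levi-Civita connection. A smooth map $\varphi:(M,g,J)\to N$ from an almost Hermitian manifold to a Riemannian manifold is weakly pluriconformal if $\langle\mathrm{d}\varphi X^{10},\mathrm{d}\varphi Y^{10}\rangle=0$ for all $X^{10},Y^{10}\in T^{10}_xM$, $x\in M$ (complex-bilinearly extended metric), and $(1,1)$-geodesic if $(\nabla\mathrm{d}\varphi)(Y^{10},Z^{01})=0$ for all $Y^{10}\in T^{10}M$, $Z^{01}\in T^{01}M$. Twistor space: $\pi:\Sigma^+N\to N$ is the bundle whose fibre at $x$ is the set of linear $J:T_xN\to T_xN$ that are orthogonal, satisfy $J^2=-\mathrm{Id}$, and are positive (bases $\{e_1,Je_1,\dots,e_n,Je_n\}$ are positively oriented). It is a subbundle of $\mathrm{End}(TN)$; the Levi-Civita connection on $\mathrm{End}(TN)$ gives a splitting $T\Sigma^+N=\mathcal{H}\oplus\mathcal{V}$, where $\mathcal{V}=\ker\mathrm{d}\pi$,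 $\mathcal{V}_{(x,J)}=\{\lambda\in\mathfrak{so}(T_xN):\lambda J=-J\lambda\}$, and $\mathcal{H}_{(x,J)}$ consists of the vectors $\mathrm{d}\sigma_x(X)$ with $\sigma$ a local section, $\sigma(x)=(x,J)$, $\nabla_X\sigma=0$. Put $\mathcal{J}^{\mathcal{H}}=(\mathrm{d}\pi|_{\mathcal{H}})^{-1}\circ J\circ\mathrm{d}\pi|_{\mathcal{H}}$ on $\mathcal{H}_{(x,J)}$ and $\mathcal{J}^{\mathcal{V}}(\lambda)=J\circ\lambda$ on $\mathcal{V}_{(x,J)}$. Then $\mathcal{J}^1=\mathcal{J}^{\mathcal{H}}\oplus\mathcal{J}^{\mathcal{V}}$ and $\mathcal{J}^2=\mathcal{J}^{\mathcal{H}}\oplus(-\mathcal{J}^{\mathcal{V}})$. *)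

(* Defs.v *)
(* MathComp-Analysis, over an abstract realType R. *)
From HB Require Import structures.
From mathcomp Require Import all_boot all_order all_algebra.
From mathcomp Require Import all_classical all_reals all_analysis.
From mathcomp.real_closed Require Export complex.

Set Implicit Arguments.
Unset Strict Implicit.
Unset Printing Implicit Defensive.

Import Order.TTheory GRing.Theory Num.Theory numFieldNormedType.Exports.

Local Open Scope classical_set_scope.
Local Open Scope ring_scope.

(* C^k and C^oo maps on an open subset U of a finite-dimensional space. *)
Fixpoint Ck (R : realType) (V W : normedModType R) (k : nat) (U : set V)
    (f : V -> W) : Prop :=
  match k with
  | 0 => forall x, U x -> {for x, continuous f}
  | k'.+1 => (forall x, U x -> differentiable f x) /\
             (forall v, Ck k' U (fun x => 'D_v f x))
  end.

Definition smooth (R : realType) (V W : normedModType R) (U : set V)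
    (f : V -> W) : Prop := forall k, Ck k U f.

Definition jac (R : realType) (d e : nat) (f : 'cV[R]_d -> 'cV[R]_e)
    (x : 'cV[R]_d) : 'M[R]_(e, d) :=
  \matrix_(i, j) ('d f x (delta_mx j 0)) i 0.

(** Smooth manifolds *)

Record chart (R : realType) (T : topologicalType) (d : nat) := Chart {
  cdom : set T;
  cfun :> T -> 'cV[R]_d;
  cinv : 'cV[R]_d -> T;
  cdom_open : open cdom;
  cimg_open : open (cfun @` cdom);
  cfunK : forall p, cdom p -> cinv (cfun p) = p;
  cfun_continuous : forall p, cdom p -> {for p, continuous cfun};
  cinv_continuous : forall x, (cfun @` cdom) x -> {for x, continuous cinv} }.

Definition cimg (R : realType) (T : topologicalType) (d : nat)
  (c : chart R T d) : set 'cV[R]_d := c @` cdom c.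

(* chart_at singles out one chart of the atlas around every point. The tangent
   space T_pM is then the space 'cV[R]_d of component vectors with respect to
   chart_at p; accordingly bilinear forms on T_pM and endomorphisms of T_pM are
   matrices, acting on columns from the left. The components with respect to
   another chart c are obtained with frame_to and frame_from below. *)
Record manifold (R : realType) (d : nat) := Manifold {
  carrier :> topologicalType;
  carrier_hausdorff : hausdorff_space carrier;
  carrier_second_countable : @second_countable carrier;
  atlas : set (chart R carrier d);
  chart_at : carrier -> chart R carrier d;
  chart_at_atlas : forall p, atlas (chart_at p);
  chart_at_dom : forall p, cdom (chart_at p) p;
  transition_smooth : forall c c', atlas c -> atlas c' ->
    smooth (c @` (cdom c `&` cdom c')) (fun x => c' (cinv c x)) }.

Definition origin (R : realType) (d : nat) (M : manifold R d) (p : M) :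
  'cV[R]_d := chart_at p p.

(* The identification of T_pM with the component space of the chart c, and its
   inverse (meaningful for p in the domain of c). *)
Definition frame_to (R : realType) (d : nat) (M : manifold R d)
    (c : chart R M d) (p : M) : 'M[R]_d :=
  jac (fun x => c (cinv (chart_at p) x)) (origin p).

Definition frame_from (R : realType) (d : nat) (M : manifold R d)
    (c : chart R M d) (p : M) : 'M[R]_d :=
  jac (fun x => chart_at p (cinv c x)) (c p).

(* Components in the chart c of a vector field, a field of endomorphisms and a
   field of bilinear forms. *)
Definition loc_vf (R : realType) (d : nat) (M : manifold R d)
    (Y : M -> 'cV[R]_d) (c : chart R M d) (x : 'cV[R]_d) : 'cV[R]_d :=
  let p := cinv c x in frame_to c p *m Y p.

Definition loc_end (R : realType) (d : nat) (M : manifold R d)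
    (A : M -> 'M[R]_d) (c : chart R M d) (x : 'cV[R]_d) : 'M[R]_d :=
  let p := cinv c x in frame_to c p *m A p *m frame_from c p.

Definition loc_form (R : realType) (d : nat) (M : manifold R d)
    (g : M -> 'M[R]_d) (c : chart R M d) (x : 'cV[R]_d) : 'M[R]_d :=
  let p := cinv c x in (frame_from c p)^T *m g p *m frame_from c p.

Definition smooth_vf (R : realType) (d : nat) (M : manifold R d)
    (Y : M -> 'cV[R]_d) : Prop :=
  forall c, atlas c -> smooth (cimg c) (loc_vf Y c).

(** Riemannian metrics and the Levi-Civita connection *)

Record riemannian (R : realType) (d : nat) (M : manifold R d) := Riemannian {
  metric :> M -> 'M[R]_d;
  metric_sym : forall p, (metric p)^T = metric p;
  metric_pos : forall p (u : 'cV[R]_d), u != 0 ->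
    0 < (u^T *m metric p *m u) 0 0;
  metric_smooth : forall c, atlas c -> smooth (cimg c) (loc_form metric c) }.

Definition inner (R : realType) (d : nat) (M : manifold R d)
    (g : riemannian M) (p : M) (u v : 'cV[R]_d) : R :=
  (u^T *m g p *m v) 0 0.

(* The vector Gamma(X, Y) of the Levi-Civita connection at the point x of the
   chart c, for component vectors X and Y:
     Gamma^k_ij = 1/2 g^kl (d_i g_jl + d_j g_il - d_l g_ij). *)
Definition christoffel (R : realType) (d : nat) (M : manifold R d)
    (g : riemannian M) (c : chart R M d) (x X Y : 'cV[R]_d) : 'cV[R]_d :=
  let G (u v : 'cV[R]_d) (z : 'cV[R]_d) : R :=
    (u^T *m loc_form g c z *m v) 0 0 in
  invmx (loc_form g c x) *m
  \col_l (2^-1 * ('D_X (G Y (delta_mx l 0)) x + 'D_Y (G X (delta_mx l 0)) x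
                  - 'D_(delta_mx l 0) (G X Y) x)).

Definition christoffel_at (R : realType) (d : nat) (M : manifold R d)
    (g : riemannian M) (p : M) (X Y : 'cV[R]_d) : 'cV[R]_d :=
  christoffel g (chart_at p) (origin p) X Y.

(* nabla_X Y at p, for X in T_pM and a vector field Y. *)
Definition nabla (R : realType) (d : nat) (M : manifold R d)
    (g : riemannian M) (p : M) (X : 'cV[R]_d) (Y : M -> 'cV[R]_d) : 'cV[R]_d :=
  'D_X (loc_vf Y (chart_at p)) (origin p) + christoffel_at g p X (Y p).

(* The induced connection on End(TM):
   (nabla_X S) Y = nabla_X (S Y) - S (nabla_X Y). *)
Definition nabla_end (R : realType) (d : nat) (M : manifold R d)
    (g : riemannian M) (p : M) (X : 'cV[R]_d) (S : M -> 'M[R]_d) : 'M[R]_d :=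
  let GX : 'M[R]_d :=
    \matrix_(i, j) (christoffel_at g p X (delta_mx j 0)) i 0 in
  'D_X (loc_end S (chart_at p)) (origin p) + (GX *m S p - S p *m GX).

(** Complexification: the complexified tangent space is 'cV[R[i]]_d *)

Definition cmx (R : realType) (k d : nat) (A : 'M[R]_(k, d)) :
    'M[R[i]]_(k, d) :=
  map_mx (real_complex R) A.

Definition remx (R : realType) (k d : nat) (A : 'M[R[i]]_(k, d)) :
    'M[R]_(k, d) :=
  map_mx (@complex.Re R) A.

Definition immx (R : realType) (k d : nat) (A : 'M[R[i]]_(k, d)) :
    'M[R]_(k, d) :=
  map_mx (@complex.Im R) A.

(* Value at (a + i b, u + i v) of the complex-bilinear extension of B. *)
Definition cbilin (R : realType) (A U : Type) (d : nat)
    (B : A -> U -> 'cV[R]_d) (a b : A) (u v : U) : 'cV[R[i]]_d :=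
  cmx (B a u - B b v) + 'i%C *: cmx (B a v + B b u).

Definition cinner (R : realType) (d : nat) (M : manifold R d)
    (g : riemannian M) (p : M) (X Y : 'cV[R[i]]_d) : R[i] :=
  (X^T *m cmx (g p) *m Y) 0 0.

Definition smooth_cvf (R : realType) (d : nat) (M : manifold R d)
    (Y : M -> 'cV[R[i]]_d) : Prop :=
  smooth_vf (fun p => remx (Y p)) /\ smooth_vf (fun p => immx (Y p)).

Definition cnabla (R : realType) (d : nat) (M : manifold R d)
    (g : riemannian M) (p : M) (Z : 'cV[R[i]]_d) (Y : M -> 'cV[R[i]]_d) :
    'cV[R[i]]_d :=
  cbilin (nabla g p) (remx Z) (immx Z)
    (fun q => remx (Y q)) (fun q => immx (Y q)).

(** Almost Hermitian and (1,2)-symplectic structures *)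

Record almost_hermitian (R : realType) (d : nat) (M : manifold R d)
    (g : riemannian M) := Hermitian {
  acs :> M -> 'M[R]_d;
  acs_smooth : forall c, atlas c -> smooth (cimg c) (loc_end acs c);
  acs_sqr : forall p, acs p *m acs p = - 1%:M;
  acs_orth : forall p u v,
    inner g p (acs p *m u) (acs p *m v) = inner g p u v }.

Definition T10 (R : realType) (d : nat) (M : manifold R d) (g : riemannian M)
    (J : almost_hermitian g) (p : M) : set 'cV[R[i]]_d :=
  [set X | cmx (J p) *m X = 'i%C *: X].

Definition T01 (R : realType) (d : nat) (M : manifold R d) (g : riemannian M)
    (J : almost_hermitian g) (p : M) : set 'cV[R[i]]_d :=
  [set X | cmx (J p) *m X = - 'i%C *: X].

Definition symplectic12 (R : realType) (d : nat) (M : manifold R d)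
    (g : riemannian M) (J : almost_hermitian g) : Prop :=
  forall Z Y : M -> 'cV[R[i]]_d,
    smooth_cvf Z -> (forall p, T01 J p (Z p)) ->
    smooth_cvf Y -> (forall p, T10 J p (Y p)) ->
    forall p, T10 J p (cnabla g p (Z p) Y).

(** Smooth maps, their differential and second fundamental form *)

Definition smooth_map (R : realType) (d e : nat) (M : manifold R d)
    (N : manifold R e) (phi : M -> N) : Prop :=
  continuous phi /\
  forall (c : chart R M d) (c' : chart R N e), atlas c -> atlas c' ->
    smooth (c @` (cdom c `&` phi @^-1` cdom c'))
           (fun x => c' (phi (cinv c x))).

Definition loc_map (R : realType) (d e : nat) (M : manifold R d)
    (N : manifold R e) (phi : M -> N) (p : M) (x : 'cV[R]_d) : 'cV[R]_e :=
  chart_at (phi p) (phi (cinv (chart_at p) x)).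

Definition dmap (R : realType) (d e : nat) (M : manifold R d)
    (N : manifold R e) (phi : M -> N) (p : M) : 'M[R]_(e, d) :=
  jac (loc_map phi p) (origin p).

(* The pull-back of the Levi-Civita connection along phi, applied to a field W
   of tangent vectors of N along phi. *)
Definition nabla_pullback (R : realType) (d e : nat) (M : manifold R d)
    (N : manifold R e) (h : riemannian N) (phi : M -> N) (p : M)
    (X : 'cV[R]_d) (W : M -> 'cV[R]_e) : 'cV[R]_e :=
  'D_X (fun x => let q := cinv (chart_at p) x in
                 frame_to (chart_at (phi p)) (phi q) *m W q) (origin p)
  + christoffel_at h (phi p) (dmap phi p *m X) (W p).

(* The field on the domain of chart_at p with constant components Y there. *)
Definition coord_field (R : realType) (d : nat) (M : manifold R d) (p : M)
    (Y : 'cV[R]_d) (q : M) : 'cV[R]_d :=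
  frame_from (chart_at p) q *m Y.

(* (nabla dphi)(X, Y) = nabla^phi_X (dphi Y) - dphi (nabla_X Y). The right-hand
   side is tensorial in Y, which is extended by coord_field. *)
Definition second_form (R : realType) (d e : nat) (M : manifold R d)
    (g : riemannian M) (N : manifold R e) (h : riemannian N) (phi : M -> N)
    (p : M) (X Y : 'cV[R]_d) : 'cV[R]_e :=
  nabla_pullback h phi p X (fun q => dmap phi q *m coord_field p Y q)
  - dmap phi p *m nabla g p X (coord_field p Y).

Definition weakly_pluriconformal (R : realType) (d e : nat) (M : manifold R d)
    (g : riemannian M) (J : almost_hermitian g) (N : manifold R e)
    (h : riemannian N) (phi : M -> N) : Prop :=
  smooth_map phi /\
  forall p X Y, T10 J p X -> T10 J p Y ->
    cinner h (phi p) (cmx (dmap phi p) *m X) (cmx (dmap phi p) *m Y) = 0.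

Definition geodesic11 (R : realType) (d e : nat) (M : manifold R d)
    (g : riemannian M) (J : almost_hermitian g) (N : manifold R e)
    (h : riemannian N) (phi : M -> N) : Prop :=
  smooth_map phi /\
  forall p Y Z, T10 J p Y -> T01 J p Z ->
    cbilin (second_form g h phi p) (remx Y) (immx Y) (remx Z) (immx Z) = 0.

(** Orientations and the twistor space *)

(* osign p tells whether the coordinate frame of chart_at p is negative;
   ocontinuous says that, for every chart, the sign of its coordinate frame is
   locally constant. *)
Definition positive_frame (R : realType) (d : nat) (M : manifold R d)
    (s : M -> bool) (p : M) (B : 'M[R]_d) : bool :=
  0 < (-1) ^+ s p * \det B.

Record orientation (R : realType) (d : nat) (M : manifold R d) := Orientation {
  osign :> M -> bool;
  ocontinuous : forall c, atlas c -> forall p, cdom c p ->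
    \forall q \near p, positive_frame osign q (frame_from c q)
                       = positive_frame osign p (frame_from c p) }.

(* The matrix with columns e_0, J e_0, ..., e_(n-1), J e_(n-1). *)
Definition complex_frame (R : realType) (n : nat) (J : 'M[R]_(n.*2))
    (e : nat -> 'cV[R]_(n.*2)) : 'M[R]_(n.*2) :=
  \matrix_(i, j) (if odd j then J *m e j./2 else e j./2) i 0.

Record twistor_at (R : realType) (n : nat) (N : manifold R n.*2)
    (h : riemannian N) (o : orientation N) (x : N) (J : 'M[R]_(n.*2)) : Prop :=
  TwistorAt {
  tw_orth : forall u v, inner h x (J *m u) (J *m v) = inner h x u v;
  tw_sqr : J *m J = - 1%:M;
  tw_pos : forall e, complex_frame J e \in unitmx ->
    positive_frame o x (complex_frame J e) }.

Record twistor (R : realType) (n : nat) (N : manifold R n.*2)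
    (h : riemannian N) (o : orientation N) := Twistor {
  tw_pi : N;
  tw_J : 'M[R]_(n.*2);
  tw_prop : twistor_at h o tw_pi tw_J }.

Definition tw_end (R : realType) (n : nat) (N : manifold R n.*2)
    (h : riemannian N) (o : orientation N) (z : twistor h o) :
    (N * 'M[R]_(n.*2))%type :=
  (tw_pi z, tw_J z).

(* The twistor space is treated as a subbundle of the total space N * 'M of
   End(TN): c induces the bundle chart end_chart c of End(TN), smoothness of a
   map into the twistor space is smoothness as a map into End(TN), and a tangent
   vector at (x, J) is given by its two components (base, fibre) in
   end_chart (chart_at x). *)
Definition end_chart (R : realType) (d : nat) (N : manifold R d)
    (c : chart R N d) (z : N * 'M[R]_d) : ('cV[R]_d * 'M[R]_d)%type :=
  (c z.1, frame_to c z.1 *m z.2 *m frame_from c z.1).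

Definition smooth_to_end (R : realType) (d e : nat) (M : manifold R d)
    (N : manifold R e) (U : set M) (s : M -> N * 'M[R]_e) : Prop :=
  (forall p, U p -> {for p, continuous (fun q => (s q).1)}) /\
  forall (c : chart R M d) (c' : chart R N e), atlas c -> atlas c' ->
    smooth (c @` (U `&` cdom c `&` [set p | cdom c' (s p).1]))
           (fun x => end_chart c' (s (cinv c x))).

Definition dmap_end (R : realType) (d e : nat) (M : manifold R d)
    (N : manifold R e) (s : M -> N * 'M[R]_e) (p : M) (X : 'cV[R]_d) :
    ('cV[R]_e * 'M[R]_e)%type :=
  'd (fun x => end_chart (chart_at (s p).1) (s (cinv (chart_at p) x)))
     (origin p) X.

Definition vertical (R : realType) (n : nat) (N : manifold R n.*2)
    (h : riemannian N) (o : orientation N) (z : twistor h o) :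
    set ('cV[R]_(n.*2) * 'M[R]_(n.*2)) :=
  [set w | [/\ w.1 = 0,
               forall u v, inner h (tw_pi z) (w.2 *m u) v
                           = - inner h (tw_pi z) u (w.2 *m v)
             & w.2 *m tw_J z = - (tw_J z *m w.2)]].

Definition horizontal (R : realType) (n : nat) (N : manifold R n.*2)
    (h : riemannian N) (o : orientation N) (z : twistor h o) :
    set ('cV[R]_(n.*2) * 'M[R]_(n.*2)) :=
  [set w | exists (U : set N) (sigma : N -> 'M[R]_(n.*2)) (X : 'cV[R]_(n.*2)),
     [/\ open U /\ U (tw_pi z),
         (forall y, U y -> twistor_at h o y (sigma y)) /\
         smooth_to_end U (fun y => (y, sigma y)),
         sigma (tw_pi z) = tw_J z,
         nabla_end h (tw_pi z) X sigma = 0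
       & w = dmap_end (fun y => (y, sigma y)) (tw_pi z) X]].

(* The graphs of J^H, J^V and J^2; the differential of the projection is the
   first component. *)
Definition JH (R : realType) (n : nat) (N : manifold R n.*2)
    (h : riemannian N) (o : orientation N) (z : twistor h o)
    (w w' : 'cV[R]_(n.*2) * 'M[R]_(n.*2)) : Prop :=
  [/\ horizontal z w, horizontal z w' & w'.1 = tw_J z *m w.1].

Definition JV (R : realType) (n : nat) (N : manifold R n.*2)
    (h : riemannian N) (o : orientation N) (z : twistor h o)
    (w w' : 'cV[R]_(n.*2) * 'M[R]_(n.*2)) : Prop :=
  [/\ vertical z w, vertical z w' & w'.2 = tw_J z *m w.2].

Definition J2 (R : realType) (n : nat) (N : manifold R n.*2)
    (h : riemannian N) (o : orientation N) (z : twistor h o)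
    (w w' : 'cV[R]_(n.*2) * 'M[R]_(n.*2)) : Prop :=
  exists a a' b b', [/\ JH z a a', JV z b b', w = a + b & w' = a' - b'].

Definition J2_holomorphic (R : realType) (d n : nat) (M : manifold R d)
    (g : riemannian M) (J : almost_hermitian g) (N : manifold R n.*2)
    (h : riemannian N) (o : orientation N) (psi : M -> twistor h o) : Prop :=
  let s := fun p => tw_end (psi p) in
  smooth_to_end setT s /\
  forall p X, J2 (psi p) (dmap_end s p X) (dmap_end s p (J p *m X)).

(* Main.v *)
From HB Require Import structures.
Require Import Defs.
From mathcomp Require Import all_boot all_order all_algebra.
From mathcomp Require Import all_classical all_reals all_analysis.
From mathcomp Require Import ring.

(** Write B for the second fundamental form of phi, S for the field of complex
structures along phi given by psi, so that psi = (phi, S), K X for the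
covariant derivative of S along phi in the direction X, and J for the almost
complex structure of M.  A tangent vector of the twistor space splits into a
horizontal part, determined by its projection to N, and a vertical part; for
the image of X under the differential of psi these are dphi X and K X.  Hence
holomorphicity of psi with respect to the second almost complex structure of
the twistor space amounts to (lemma [tw_structure])

      dphi (J X) = S (dphi X),    K (J X) = - S (K X),    K X S = - S K X,

the last relation expressing that K X is vertical.

The first relation says that dphi maps (1,0)-vectors to i-eigenvectors of S.
As S is orthogonal, the complex-bilinear metric vanishes on a pair of such
eigenvectors, so phi is weakly pluriconformal ([dmap_isotropic]).

Covariant differentiation of dphi J = S dphi gives ([second_form_acs])

      B (X, J Y) + dphi ((nabla_X J) Y) = K X (dphi Y) + S (B (X, Y)).

Replace X, Y by J X, J Y.  The relations for K change the sign of the K-term,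
and the (1,2)-symplectic condition, which for real vectors reads
nabla_(J X) J = - J (nabla_X J), changes the sign of the term with nabla J.
Adding the two identities leaves

      B (X, J Y) - B (J X, Y) = S (B (X, Y) + B (J X, J Y)).

Since B is symmetric, the left-hand side is antisymmetric in X and Y and the
right-hand side is symmetric, so both vanish: B (X, Y) + B (J X, J Y) = 0
([second_form_11]).  For complex vectors this is the (1,1)-geodesic condition.

Two analytic facts carry the computation.  Symmetry of B rests on the symmetry
of second derivatives ([Schwarz]) and of the Christoffel symbols.  The
(1,2)-symplectic condition quantifies over globally defined smooth fields of
type (0,1) and (1,0), so to read it at a point one needs such fields with a
prescribed value; they come from smooth bump functions ([smooth_bump],
[vf_extension]). *)

Set Implicit Arguments.
Unset Strict Implicit.
Unset Printing Implicit Defensive.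

Import Order.TTheory GRing.Theory Num.Theory numFieldNormedType.Exports.

Local Open Scope classical_set_scope.
Local Open Scope ring_scope.

(** * Differentiation of maps between normed modules *)

Section Differentials.
Variable R : realType.
Implicit Types T U V W : normedModType R.

Lemma linear_is_diff V W (L : V -> W) (x : V) :
  linear L -> continuous L -> is_diff x L L.
Proof.
move=> linL contL.
pose aL := GRing.isLinear.Build _ _ _ _ _ linL.
pose L' : {linear V -> W} := HB.pack L aL.
apply: DiffDef; first exact: (@linear_differentiable R V W L').
by rewrite (diff_lin (f := L')).
Qed.

Lemma bilinear_is_diff U T V W (b : {bilinear U -> T -> W}) (f : V -> U)
    (g : V -> T) (x : V) :
  continuous (fun p : U * T => b p.1 p.2) ->
  differentiable f x -> differentiable g x ->
  is_diff x (fun y => b (f y) (g y))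
            (fun v => b (f x) ('d g x v) + b ('d f x v) (g x)).
Proof.
move=> bc df dg.
have dp := differentiable_pair df dg.
have db := @differentiable_bilin _ _ _ _ b (f x, g x) bc.
apply: DiffDef; first exact: (differentiable_comp dp db).
rewrite -[LHS]/('d ((fun p : U * T => b p.1 p.2) \o (fun y => (f y, g y))) x
                 : V -> W).
by rewrite (diff_comp dp db) (diff_bilin _ bc) (diff_pair df dg).
Qed.

Lemma derive_bilinear U T V W (b : {bilinear U -> T -> W}) (f : V -> U)
    (g : V -> T) (x v : V) :
  continuous (fun p : U * T => b p.1 p.2) ->
  differentiable f x -> differentiable g x ->
  'D_v (fun y => b (f y) (g y)) x = b ('D_v f x) (g x) + b (f x) ('D_v g x).
Proof.
move=> bc df dg; have [d e] := bilinear_is_diff bc df dg.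
by rewrite !deriveE// e addrC.
Qed.

Lemma derive_linear V U W (L : U -> W) (f : V -> U) (x v : V) :
  linear L -> continuous L -> differentiable f x ->
  'D_v (fun y => L (f y)) x = L ('D_v f x).
Proof.
move=> linL contL df; have [dL eL] := linear_is_diff (f x) linL contL.
rewrite (deriveE _ df) -[fun y => _]/(L \o f) deriveE; last first.
  exact: differentiable_comp.
by rewrite diff_comp//= eL.
Qed.

Lemma derive_dirD V W (f : V -> W) (x u v : V) :
  differentiable f x -> 'D_(u + v) f x = 'D_u f x + 'D_v f x.
Proof. by move=> df; rewrite !deriveE// linearD. Qed.

Lemma derive_dirZ V W (f : V -> W) (x v : V) (c : R) :
  differentiable f x -> 'D_(c *: v) f x = c *: 'D_v f x.
Proof. by move=> df; rewrite !deriveE// linearZ. Qed.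

Lemma derive_comp V U W (f : V -> U) (g : U -> W) (x v : V) :
  differentiable f x -> differentiable g (f x) ->
  'D_v (fun y => g (f y)) x = 'D_('D_v f x) g (f x).
Proof.
move=> df dg; rewrite -[fun y => _]/(g \o f) !deriveE//; last first.
  exact: differentiable_comp.
by rewrite diff_comp.
Qed.

(** Differentiability at a point depends only on the germ of the map, which is
what allows all later identities to be checked in a neighbourhood only. *)
Lemma near_eq_is_diff V W (f g : V -> W) (x : V) :
  (\near x, f x = g x) -> differentiable f x -> is_diff x g ('d f x).
Proof.
move=> fg df; have fgx := nbhs_singleton fg.
have dc := diff_continuous df.
have e : g \o shift x = cst (g x) + 'd f x +o_ 0 id.
  have /eqaddoE/eqaddoP fo := diff_locally df.
  apply/eqaddoP => _/posnumP[eps]; near=> h.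
  have fgh : f (h + x) = g (h + x).
    near: h; move: fg; rewrite (near_shift 0 x).
    by apply: filterS => h /=; rewrite subr0.
  rewrite -[X in `|X|]/(g (h + x) - (g x + 'd f x h)) -fgh -fgx.
  near: h; exact: fo.
have E := diff_unique dc e.
by apply: DiffDef => //; apply/diff_locallyP; rewrite E.
Unshelve. all: by end_near. Qed.

Lemma cvg_mx m n V (f : V -> 'M[R]_(m, n)) (x : V) :
  (forall i j, {for x, continuous (fun y => f y i j)}) ->
  {for x, continuous f}.
Proof.
move=> fc; apply/cvgrPdist_le => /= e e0; near=> y.
rewrite /Num.Def.normr/= mx_normrE (bigmax_le _ (ltW e0))//= => i _.
rewrite !mxE/=.
move: i; near: y; apply: filter_forall => /= i.
exact: ((cvgrPdist_le _ _).1 (fc i.1 i.2)).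
Unshelve. all: by end_near. Qed.

Lemma mulmx_continuous m n q :
  continuous (fun p : 'M[R]_(m, n) * 'M[R]_(n, q) => p.1 *m p.2).
Proof.
move=> p; apply: cvg_mx => i j.
rewrite (_ : (fun _ => _) = fun y : 'M[R]_(m, n) * 'M[R]_(n, q) =>
  \sum_k y.1 i k * y.2 k j); last by apply/funext => y; rewrite mxE.
rewrite /prop_for/continuous_at.
apply: (@cvg_big R 'I_n +%R 0 predT _ _ (nbhs p) (index_enum 'I_n)
  (fun k (y : 'M[R]_(m, n) * 'M[R]_(n, q)) => y.1 i k * y.2 k j)
  (fun k => p.1 i k * p.2 k j)).
  exact: add_continuous.
move=> k _; apply: cvgM.
  by apply: (cvg_comp (@fst _ _) (fun A : 'M[R]_(m, n) => A i k));
    [exact: cvg_fst|exact: coord_continuous].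
by apply: (cvg_comp (@snd _ _) (fun A : 'M[R]_(n, q) => A k j));
    [exact: cvg_snd|exact: coord_continuous].
Qed.

End Differentials.

(** * Differentiability class C^k *)

Section MatrixDifferentials.
Variables (R : realType) (V : normedModType R).

Lemma mulmx_differentiable m n q (A : V -> 'M[R]_(m, n)) (B : V -> 'M[R]_(n, q))
    (x : V) :
  differentiable A x -> differentiable B x ->
  differentiable (fun y => A y *m B y) x.
Proof.
by move=> dA dB; have [] := bilinear_is_diff (@mulmx_continuous R m n q) dA dB.
Qed.

Lemma derive_mulmx m n q (A : V -> 'M[R]_(m, n)) (B : V -> 'M[R]_(n, q))
    (x v : V) :
  differentiable A x -> differentiable B x ->
  'D_v (fun y => A y *m B y) x = 'D_v A x *m B x + A x *m 'D_v B x.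
Proof.
by move=> dA dB; exact: (derive_bilinear v (@mulmx_continuous R m n q)).
Qed.

Lemma derive_mulmxr m n q (A : V -> 'M[R]_(m, n)) (B : 'M[R]_(n, q)) (x v : V) :
  differentiable A x -> 'D_v (fun y => A y *m B) x = 'D_v A x *m B.
Proof.
move=> dA; apply: etrans (derive_mulmx v dA (differentiable_cst B x)) _.
by rewrite derive_cst mulmx0 addr0.
Qed.

Lemma derive_coord m n (A : V -> 'M[R]_(m, n)) (x v : V) i j :
  differentiable A x -> 'D_v (fun y => A y i j) x = ('D_v A x) i j.
Proof.
move=> dA; apply: (derive_linear (L := fun M : 'M[R]_(m, n) => M i j)) => //.
- by move=> a B C; rewrite !mxE.
- exact: coord_continuous.
Qed.

Lemma coord_differentiable m n (A : V -> 'M[R]_(m, n)) (x : V) i j :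
  differentiable A x -> differentiable (fun y => A y i j) x.
Proof.
move=> dA.
apply: (@differentiable_comp _ _ _ _ A (fun M : 'M[R]_(m, n) => M i j)) => //.
exact: differentiable_coord.
Qed.

End MatrixDifferentials.

Section Regularity.
Variable R : realType.
Implicit Types T U V W : normedModType R.

Lemma Ck_local V W k (A : set V) (f : V -> W) :
  (forall x, A x -> exists2 B, B x & Ck k B f) -> Ck k A f.
Proof.
elim: k f => [|k IH] f loc /=.
  by move=> x /loc[B Bx]; exact.
split=> [x /loc[B Bx [df _]]|v]; first exact: df.
by apply: IH => x /loc[B Bx [_ Df]]; exists B => //; exact: Df.
Qed.

Lemma Ck_subset V W k (A B : set V) (f : V -> W) :
  B `<=` A -> Ck k A f -> Ck k B f.
Proof. by move=> BA fA; apply: Ck_local => x /BA Ax; exists A. Qed.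

Lemma Ck_congr V W k (A : set V) (f g : V -> W) :
  open A -> (forall x, A x -> f x = g x) -> Ck k A f -> Ck k A g.
Proof.
move=> Aop; elim: k f g => [|k IH] f g fg /=.
  move=> cf x Ax; have nA : nbhs x A by apply: open_nbhs_nbhs; split.
  rewrite /prop_for/continuous_at -fg//.
  apply: (cvg_trans _ (cf x Ax)); apply: near_eq_cvg.
  by apply: filterS nA => y /fg.
have near_fg x : A x -> \near x, f x = g x.
  move=> Ax; have nA : nbhs x A by apply: open_nbhs_nbhs; split.
  by apply: filterS nA => y /fg.
move=> [df Df]; split=> [x Ax|v].
  by have [] := near_eq_is_diff (near_fg x Ax) (df x Ax).
by apply: IH (Df v) => x Ax; exact/near_eq_derive/near_fg.
Qed.

Lemma Ck_pred V W k (A : set V) (f : V -> W) : Ck k.+1 A f -> Ck k A f.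
Proof.
elim: k f => [|k IH] f [df Df] /=.
  by move=> x /df; exact: differentiable_continuous.
by split=> // v; exact/IH/Df.
Qed.

Lemma Ck_cst V W k (A : set V) (w : W) : Ck k A (fun=> w).
Proof.
elim: k w => [|k IH] w /=; first by move=> x _; exact: cst_continuous.
split=> [x _|v]; first exact: differentiable_cst.
rewrite (_ : (fun x => 'D_v (fun=> w) x) = fun=> 0) //; apply/funext => x.
exact: (derive_cst w).
Qed.

Lemma Ck_id V k (A : set V) : Ck k A (fun x => x).
Proof.
case: k => [|k]; first by move=> x _; exact: cvg_id.
split=> [x _|v]; first by have [] := is_diff_id x.
rewrite (_ : (fun x => 'D_v (fun y => y) x) = fun=> v); first exact: Ck_cst.
by apply/funext => x; exact: derive_id.
Qed.

Lemma Ck_add V W k (A : set V) (f g : V -> W) : open A ->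
  Ck k A f -> Ck k A g -> Ck k A (fun x => f x + g x).
Proof.
move=> Aop; elim: k f g => [|k IH] f g /=.
  by move=> cf cg x Ax; apply: continuousD; [exact: cf|exact: cg].
move=> [df Df] [dg Dg]; split=> [x Ax|v].
  by apply: differentiableD; [exact: df|exact: dg].
apply: Ck_congr (IH _ _ (Df v) (Dg v)) => // x Ax.
by rewrite [RHS]deriveD//; apply: diff_derivable; [exact: df|exact: dg].
Qed.

Lemma Ck_sum V W k n (A : set V) (f : 'I_n -> V -> W) : open A ->
  (forall i, Ck k A (f i)) -> Ck k A (fun x => \sum_i f i x).
Proof.
move=> Aop fA; elim: n f fA => [|n IH] f fA.
  rewrite (_ : (fun _ => _) = fun=> 0); first exact: Ck_cst.
  by apply/funext => x; rewrite big_ord0.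
rewrite (_ : (fun _ => _) = fun x =>
  (\sum_(i < n) f (widen_ord (leqnSn n) i) x) + f ord_max x); last first.
  by apply/funext => x; rewrite big_ord_recr.
by apply: Ck_add => //; apply: IH => i; exact: fA.
Qed.

Lemma Ck_linear V U W k (A : set V) (L : U -> W) (f : V -> U) : open A ->
  linear L -> continuous L -> Ck k A f -> Ck k A (fun x => L (f x)).
Proof.
move=> Aop linL contL; elim: k f => [|k IH] f /=.
  by move=> cf x Ax; apply: continuous_comp; [exact: cf|exact: contL].
move=> [df Df]; split=> [x Ax|v].
  have [dL _] := linear_is_diff (f x) linL contL.
  by apply: (differentiable_comp (df x Ax) dL).
apply: Ck_congr (IH _ (Df v)) => // x Ax.
by rewrite (derive_linear v linL contL (df x Ax)).
Qed.

(** The Leibniz rule lowers the order by one in one factor at a time, so the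
induction needs both factors at the lower order as well. *)
Lemma Ck_bilinear V T U W k (A : set V) (b : {bilinear T -> U -> W})
    (f : V -> T) (g : V -> U) :
  open A -> continuous (fun p : T * U => b p.1 p.2) ->
  Ck k A f -> Ck k A g -> Ck k A (fun x => b (f x) (g x)).
Proof.
move=> Aop bc; elim: k f g => [|k IH] f g.
  move=> cf cg x Ax.
  apply: (@continuous_comp _ _ _ (fun y => (f y, g y))
    (fun p : T * U => b p.1 p.2)); last exact: bc.
  by apply: cvg_pair => /=; [exact: cf|exact: cg].
move=> Cf Cg; have [df Df] := Cf; have [dg Dg] := Cg; split=> [x Ax|v].
  by have [] := bilinear_is_diff bc (df x Ax) (dg x Ax).
have C1 := IH _ _ (Df v) (Ck_pred Cg).
have C2 := IH _ _ (Ck_pred Cf) (Dg v).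
apply: Ck_congr (Ck_add Aop C1 C2) => // x Ax.
by rewrite (derive_bilinear v bc (df x Ax) (dg x Ax)).
Qed.

Lemma Ck_mulmx V k m n q (A : set V) (f : V -> 'M[R]_(m, n))
    (g : V -> 'M[R]_(n, q)) : open A ->
  Ck k A f -> Ck k A g -> Ck k A (fun x => f x *m g x).
Proof. by move=> Aop; apply: Ck_bilinear => //; exact: mulmx_continuous. Qed.

Lemma Ck_coord V k m n (A : set V) (f : V -> 'M[R]_(m, n)) i j : open A ->
  Ck k A f -> Ck k A (fun x => f x i j).
Proof.
move=> Aop; apply: (Ck_linear (L := fun M : 'M[R]_(m, n) => M i j)) => //.
- by move=> a B C; rewrite !mxE.
- exact: coord_continuous.
Qed.

Lemma diff_basis W d (f : 'cV[R]_d -> W) (x v : 'cV[R]_d) :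
  differentiable f x ->
  'D_v f x = \sum_j v j 0 *: 'D_(delta_mx j 0) f x.
Proof.
move=> df; rewrite deriveE// [v in LHS](_ : v = \sum_j v j 0 *: delta_mx j 0).
  by rewrite linear_sum/=; apply: eq_bigr => j _; rewrite linearZ/= deriveE.
apply/colP => i; rewrite summxE (bigD1 i)//= !mxE !eqxx mulr1 big1 ?addr0//.
by move=> j ji; rewrite !mxE eq_sym (negPf ji) mulr0.
Qed.

(** The induction uses the chain rule in the form D_v (f o g) = sum_j (D_v g)_j
(D_(e_j) f o g), whose terms are products of maps of class C^k. *)
Lemma Ck_comp V d e k (A : set V) (B : set 'cV[R]_d) (g : V -> 'cV[R]_d)
    (f : 'cV[R]_d -> 'cV[R]_e) :
  open A -> (forall x, A x -> B (g x)) ->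
  Ck k A g -> Ck k B f -> Ck k A (fun x => f (g x)).
Proof.
move=> Aop gA; elim: k f => [|k IH] f.
  by move=> cg cf x Ax; apply: continuous_comp; [exact: cg|exact/cf/gA].
move=> Cg [df Df]; have [dg Dg] := Cg; split=> [x Ax|v].
  by apply: differentiable_comp; [exact: dg|exact/df/gA].
have C : Ck k A (fun x => \sum_j 'D_(delta_mx j 0) f (g x) *m
                                 ((delta_mx 0 j : 'rV_d) *m 'D_v g x)).
  apply: Ck_sum => // j; apply: Ck_mulmx => //.
    by apply: IH (Df _); exact: Ck_pred.
  by apply: Ck_mulmx => //; [exact: Ck_cst|exact: Dg].
apply: Ck_congr C => // x Ax.
rewrite (derive_comp v (dg x Ax) (df _ (gA x Ax))) diff_basis; last exact/df/gA.
apply: eq_bigr => j _; apply/colP => i; rewrite !mxE big_ord1 mulrC -rowE.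
by rewrite !mxE.
Qed.

Lemma scalar_mx_continuous : continuous (fun a : R => a%:M : 'M[R]_1).
Proof.
move=> a; apply: cvg_mx => i j; rewrite (_ : (fun _ => _) = id).
  exact: cvg_id.
by apply/funext => b; rewrite !ord1 mxE eqxx mulr1n.
Qed.

Lemma Ck_scale (V : normedModType R) k n (A : set V) (f : V -> R)
    (G : V -> 'cV[R]_n) : open A -> Ck k A f -> Ck k A G ->
  Ck k A (fun x => f x *: G x).
Proof.
move=> Aop Cf CG.
rewrite (_ : (fun x => _) = fun x => G x *m (f x)%:M); last first.
  by apply/funext => x; rewrite mul_mx_scalar.
apply: Ck_mulmx => //.
apply: (Ck_linear (L := fun a : R => a%:M : 'M[R]_1)) => //.
  by move=> a b e; apply/matrixP => i j; rewrite !ord1 !mxE eqxx !mulr1n.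
exact: scalar_mx_continuous.
Qed.

End Regularity.

(** * Symmetry of second derivatives *)

Section Schwarz.
Variables (R : realType) (V : normedModType R).
Implicit Types (A : set V) (f : V -> R).

Lemma line_MVT f (a v : V) (h : R) : 0 <= h ->
  (forall t, 0 <= t <= h -> differentiable f (a + t *: v)) ->
  exists2 t, 0 <= t <= h & f (a + h *: v) - f a = h * 'D_v f (a + t *: v).
Proof.
move=> h0 df.
have dl t : is_derive t (1 : R) (fun s : R => a + s *: v) v.
  have dd : is_diff t (fun s : R => a + s *: v) (fun s => s *: v).
    apply: is_diff_eq; apply/funext => s /=.
    by rewrite /= add0r.
  have [d e] := dd.
  split; first exact: diff_derivable.
  by rewrite deriveE// e scale1r.
have dl' t : differentiable (fun s : R => a + s *: v) t.
  by apply/derivable1_diffP; have [] := dl t.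
have dphi t : 0 <= t <= h ->
    is_derive t 1 (fun s => f (a + s *: v)) ('D_v f (a + t *: v)).
  move=> th; have dc := differentiable_comp (dl' t) (df t th).
  split; first exact: diff_derivable dc.
  rewrite (@derive_comp R _ _ _ (fun s : R => a + s *: v) f)//; last exact: df.
  by have [_ ->] := dl t.
have [t||c] := @MVT_segment R (fun s => f (a + s *: v))
    (fun s => 'D_v f (a + s *: v)) 0 h h0.
- by rewrite in_itv/= => /andP[/ltW t0 /ltW th]; apply: dphi; rewrite t0 th.
- apply: derivable_within_continuous => t; rewrite in_itv/= => th.
  by have [] := dphi t th.
- rewrite in_itv/= => ch; rewrite scale0r addr0 subr0 mulrC => e.
  by exists c.
Qed.

(** The second difference of f over the parallelogram spanned by h u and h v is
h^2 times a mixed derivative at some point of it: the mean value theorem in the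
direction v for y |-> f (y + h u) - f y, then in the direction u for D_v f. *)
Lemma mixed_difference f A (x u v : V) (h : R) : 0 <= h -> Ck 2 A f ->
  (forall s t, 0 <= s <= h -> 0 <= t <= h -> A (x + s *: u + t *: v)) ->
  exists s t, [/\ 0 <= s <= h, 0 <= t <= h &
    f (x + h *: v + h *: u) - f (x + h *: v) - (f (x + h *: u) - f x)
    = h * (h * 'D_u ('D_v f) (x + s *: u + t *: v))].
Proof.
move=> h0 [df Df] inA.
have hh : 0 <= h <= h by rewrite h0 lexx.
have h00 : 0 <= (0 : R) <= h by rewrite h0 lexx.
pose F y := f (y + h *: u) - f y.
have dsh (y : V) : is_diff y (fun z => z + h *: u) id.
  apply: is_diff_eq; apply/funext => s /=; exact: addr0.
have dF t : 0 <= t <= h -> differentiable F (x + t *: v) /\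
   'D_v F (x + t *: v) = 'D_v f (x + h *: u + t *: v) - 'D_v f (x + t *: v).
  move=> th.
  have d1 : differentiable f (x + t *: v).
    by apply: df; have := inA _ _ h00 th; rewrite scale0r addr0.
  have d2 : differentiable f (x + t *: v + h *: u).
    by apply: df; rewrite addrAC; exact: inA.
  have [ds es] := dsh (x + t *: v).
  have d3 := differentiable_comp ds d2.
  split; first exact: differentiableB.
  rewrite deriveB; try exact: diff_derivable.
  rewrite (@derive_comp R _ _ _ (fun z => z + h *: u) f)//.
  by rewrite (deriveE _ ds) es addrAC.
have [t th e] := line_MVT h0 (fun t th => (dF t th).1).
move: e; rewrite (dF t th).2 /F => e.
have [|s sh e'] := @line_MVT ('D_v f) (x + t *: v) u h h0.
  by move=> s sh; apply: (Df v).1; rewrite addrAC; exact: inA.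
exists s, t; split => //; rewrite e; congr (_ * _).
by rewrite [x + h *: u + _]addrAC [x + s *: u + _]addrAC.
Qed.

(** The second difference is the same in both orders of u and v, so by
[mixed_difference] the two mixed derivatives agree at some pair of points in
any small parallelogram at x; continuity lets these points tend to x. *)
Lemma Schwarz_scalar f A (x u v : V) : open A -> A x -> Ck 2 A f ->
  'D_u ('D_v f) x = 'D_v ('D_u f) x.
Proof.
move=> Aop Ax C2; have [df Df] := C2.
apply/eqP; rewrite -subr_eq0 -normr_le0; apply/ler_addgt0Pl => e e0.
rewrite addr0.
have e20 : 0 < e / 2 by rewrite divr_gt0.
have /cvgrPdist_le/(_ _ e20) c1 := (Df v).2 u x Ax.
have /cvgrPdist_le/(_ _ e20) c2 := (Df u).2 v x Ax.
have nA : nbhs x A by apply: open_nbhs_nbhs; split.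
have [r /= r0 rA] := (nbhs_ballP _ _).1 (filterI nA (filterI c1 c2)).
(* The summand 1 keeps the denominator positive when u = v = 0. *)
pose K := `|u| + `|v| + 1.
have K0 : 0 < K by rewrite ltr_pwDr// addr_ge0.
pose h := r / 2 / K.
have h0 : 0 < h by rewrite !divr_gt0.
have inb s t : 0 <= s <= h -> 0 <= t <= h -> ball x r (x + s *: u + t *: v).
  move=> /andP[s0 sh] /andP[t0 th]; rewrite -ball_normE/=.
  rewrite -addrA opprD addNKr normrN (le_lt_trans (ler_normD _ _))//.
  rewrite !normrZ !ger0_norm//.
  apply: (@le_lt_trans _ _ (h * K)).
    rewrite /K 2!mulrDr mulr1 -[leLHS]addr0; apply: lerD; last exact: ltW.
    by apply: lerD; apply: ler_wpM2r.
  by rewrite /h divfK ?gt_eqF// ltr_pdivrMr// ltr_pMr// ltr1n.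
have [s [t [sh th E1]]] := mixed_difference (ltW h0) C2
  (fun s t sh th => (rA _ (inb s t sh th)).1).
have inb' s' t' : 0 <= s' <= h -> 0 <= t' <= h ->
    ball x r (x + s' *: v + t' *: u).
  by move=> ? ?; rewrite addrAC; exact: inb.
have [s' [t' [sh' th' E2]]] := mixed_difference (ltW h0) C2
  (fun s t sh th => (rA _ (inb' s t sh th)).1).
have E : 'D_u ('D_v f) (x + s *: u + t *: v)
       = 'D_v ('D_u f) (x + s' *: v + t' *: u).
  apply: (mulfI (lt0r_neq0 h0)); apply: (mulfI (lt0r_neq0 h0)).
  apply: etrans (esym E1) (etrans _ E2).
  rewrite [x + h *: v + h *: u]addrAC !opprB -!addrA; congr (_ + _).
  by rewrite addrCA [RHS]addrCA; congr (_ + _); rewrite addrC.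
have [_ [b1 _]] := rA _ (inb _ _ sh th).
have [_ [_ b2]] := rA _ (inb' _ _ sh' th').
rewrite (_ : _ - _ = ('D_u ('D_v f) x - 'D_u ('D_v f) (x + s *: u + t *: v))
   - ('D_v ('D_u f) x - 'D_v ('D_u f) (x + s' *: v + t' *: u))); last first.
  by rewrite E opprB addrA subrK.
apply: le_trans (ler_normB _ _) _; rewrite [leRHS]splitr; exact: lerD b1 b2.
Qed.

End Schwarz.

Lemma Schwarz (R : realType) (V : normedModType R) m n (f : V -> 'M[R]_(m, n))
    (A : set V) (x u v : V) : open A -> A x -> Ck 2 A f ->
  'D_u ('D_v f) x = 'D_v ('D_u f) x.
Proof.
move=> Aop Ax C2; have [df Df] := C2.
have nA : nbhs x A by apply: open_nbhs_nbhs; split.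
have C w z i j : ('D_w ('D_z f) x) i j = 'D_w ('D_z (fun y => f y i j)) x.
  apply: etrans (esym (derive_coord w i j ((Df z).1 x Ax))) _.
  apply: near_eq_derive; apply: filterS nA => y Ay.
  by apply: esym; exact: derive_coord (df y Ay).
apply/matrixP => i j; apply: etrans (C u v i j) (etrans _ (esym (C v u i j))).
exact: (Schwarz_scalar u v Aop Ax (Ck_coord i j Aop C2)).
Qed.

(** * Smooth bump functions *)

Section Bump.
Variable R : realType.

(** For p = 1 this is the classical function exp (- 1 / t) that is flat at 0.
The polynomial factor in 1 / t makes the family closed under differentiation.
*)
Definition flat (p : {poly R}) (t : R) : R :=
  if 0 < t then p.[t^-1] * expR (- t^-1) else 0.

(** The exponential series gives (1 / t)^(k + 2) <= (k + 2)! exp (1 / t), which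
beats a polynomial of degree less than k in 1 / t by a factor t^2. *)
Lemma flat_bound (p : {poly R}) :
  exists2 C, 0 <= C & forall t, `|t| <= 1 -> `|flat p t| <= C * t ^+ 2.
Proof.
pose k := size p.
pose C := \sum_(i < k) `|p`_i|.
have C0 : 0 <= C by apply: sumr_ge0.
exists (C * (k.+2)`!%:R) => [|t t1]; first by rewrite mulr_ge0.
rewrite /flat; case: ifPn => t0; last first.
  by rewrite normr0 mulr_ge0 ?sqr_ge0 ?mulr_ge0.
have y1 : 1 <= t^-1 by rewrite invf_ge1// (le_trans (ler_norm t)).
have y0 : 0 <= t^-1 by rewrite invr_ge0 ltW.
have pb : `|p.[t^-1]| <= C * t^-1 ^+ k.
  rewrite horner_coef (le_trans (ler_norm_sum _ _ _))// /C mulr_suml.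
  apply: ler_sum => i _.
  rewrite normrM ler_wpM2l// normrX ger0_norm//.
  by rewrite ler_weXn2l// ltnW.
have eb : t^-1 ^+ k * expR (- t^-1) <= (k.+2)`!%:R * t ^+ 2.
  have f0 : 0 < (k.+2)`!%:R :> R by rewrite ltr0n fact_gt0.
  rewrite expRN ler_pdivrMr ?expR_gt0//.
  set F : R := (k.+2)`!%:R in f0 *.
  have -> : t^-1 ^+ k = F * t ^+ 2 * (t^-1 ^+ k.+2 / F).
    rewrite !exprS; field.
    by rewrite (gt_eqF t0) (gt_eqF f0).
  rewrite ler_wpM2l// ?mulr_ge0 ?exprn_ge0 ?(ltW t0) ?(ltW f0)//.
  by rewrite (le_trans _ (expR_ge1Dxn k.+1 y0))// lerDr.
rewrite normrM (ger0_norm (expR_ge0 _)).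
apply: (@le_trans _ _ (C * t^-1 ^+ k * expR (- t^-1))).
  by rewrite ler_wpM2r// expR_ge0.
by rewrite -!mulrA ler_wpM2l// mulrA.
Qed.

(** The derivative again belongs to the family, so that all members are smooth;
at 0 it vanishes because of the quadratic bound [flat_bound]. *)
Lemma is_derive_flat (p : {poly R}) (t : R) :
  is_derive t 1 (flat p) (flat ('X^2 * (p - p^`())) t).
Proof.
have [t0|t0|->] := ltgtP t 0.
- rewrite {2}/flat ltNge (ltW t0)/=.
  have nz : \near t, cst 0 t = flat p t.
    near=> s; rewrite /flat/= ltNge (_ : s <= 0)//.
    by apply/ltW; near: s; exact: lt_nbhsl.
  exact: near_eq_is_derive nz (is_derive_cst (0 : R) t 1).
- rewrite {2}/flat t0.
  pose f (s : R) := p.[s^-1] * expR (- s^-1).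
  have nf : \near t, f t = flat p t.
    near=> s; rewrite /flat/= (_ : 0 < s)//.
    by near: s; exact: lt_nbhsr.
  apply: near_eq_is_derive nf _.
  have tn0 : t != 0 by rewrite gt_eqF.
  have di : is_derive t 1 (fun s : R => s^-1) (- t ^- 2).
    have dv := is_deriveV (f := id) tn0 (is_derive_id t 1).
    by apply: (is_derive_eq dv); exact: mulr1.
  have dp : is_derive t 1 (fun s : R => p.[s^-1]) (p^`().[t^-1] * - t ^- 2).
    exact: (is_derive1_comp (f := horner p)).
  have de : is_derive t 1 (fun s : R => expR (- s^-1)) (expR (- t^-1) * t ^- 2).
    apply: (is_derive1_comp (f := expR) (g := fun s : R => - s^-1)).
    by rewrite -[t ^- 2]opprK; exact: is_deriveN.
  have := is_deriveM dp de.
  rewrite /f => dpe; apply: (is_derive_eq dpe).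
  rewrite !hornerE /= exprVn /GRing.scale/=; ring.
- rewrite {2}/flat ltxx.
  have [C C0 Cb] := flat_bound p.
  (* At 0 the difference quotient is bounded by a multiple of the increment. *)
  have c : h^-1 *: ((flat p \o shift 0) (h *: 1) - flat p 0) @[h --> 0^']
      --> (0 : R).
    apply/cvgrPdist_le => e e0; near=> h.
    have h0 : h != 0 by near: h; exact: nbhs_dnbhs_neq.
    rewrite /= sub0r normrN addr0 /flat ltxx subr0 -/(flat p _).
    rewrite [h *: 1]mulr1 normrM normfV ler_pdivrMl ?normr_gt0//.
    have h1 : `|h| <= 1 by near: h; apply: dnbhs0_le.
    rewrite (le_trans (Cb h h1))// -real_normK ?num_real// mulrC expr2 -mulrA.
    rewrite ler_wpM2l//.
    have hC : `|h| <= e / (C + 1).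
      by near: h; apply: dnbhs0_le; rewrite divr_gt0// ltr_pwDr.
    rewrite (le_trans (ler_wpM2r C0 hC))// mulrAC ler_pdivrMr ?ltr_pwDr//.
    by rewrite ler_wpM2l ?lerDl// ltW.
  split; first by apply/cvg_ex; exists 0.
  exact: (cvg_lim _ c).
Unshelve. all: by end_near. Qed.

(** The statement is for all p at once because the derivative changes p. *)
Lemma Ck_flat (V : normedModType R) (A : set V) k (p : {poly R}) (q : V -> R) :
  open A -> Ck k A q -> Ck k A (fun x => flat p (q x)).
Proof.
move=> Aop; elim: k p => [|k IH] p.
  move=> cq x Ax; apply: continuous_comp; first exact: cq.
  apply: differentiable_continuous; apply/derivable1_diffP.
  by have [] := is_derive_flat p (q x).
move=> Cq; have [dq Dq] := Cq.
have dflat s : differentiable (flat p) s.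
  by apply/derivable1_diffP; have [] := is_derive_flat p s.
split=> [x Ax|v].
  by apply: differentiable_comp; [exact: dq|exact: dflat].
have C : Ck k A (fun x => 'D_v q x * flat ('X^2 * (p - p^`())) (q x)).
  apply: (Ck_bilinear (b := @GRing.mul R)) (Dq v) _ => //.
    exact: mul_continuous.
  exact/IH/Ck_pred.
apply: Ck_congr C => // x Ax.
rewrite (derive_comp v (dq x Ax) (dflat _)).
have [_ <-] := is_derive_flat p (q x).
have /= E := derive_dirZ (1 : R) ('D_v q x) (dflat (q x)).
have e1 : 'D_v q x *: (1 : R) = 'D_v q x by exact: mulr1.
by rewrite e1 in E.
Qed.

Lemma box_compact d (a : 'cV[R]_d) (r : R) :
  compact [set x : 'cV[R]_d | forall i, `|x i 0 - a i 0| <= r].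
Proof.
have C : compact
    [set v : 'rV[R]_d | forall i, v ord0 i \in `[a i 0 - r, a i 0 + r]].
  apply: (@rV_compact _ _ (fun i => `[a i 0 - r, a i 0 + r]%classic)) => i.
  exact: segment_compact.
rewrite (_ : mkset _ = trmx @` [set v : 'rV[R]_d |
   forall i, v ord0 i \in `[a i 0 - r, a i 0 + r]]).
  apply: continuous_compact C; apply: continuous_subspaceT => x.
  apply: cvg_mx => i j.
  rewrite (_ : (fun _ => _) = fun y : 'rV[R]_d => y j i).
    exact: coord_continuous.
  by apply/funext => y; rewrite mxE.
apply/seteqP; split=> [x xb|_ [y yb <-] i] /=.
  exists x^T; last by rewrite trmxK.
  by move=> i; rewrite mxE in_itv/= -ler_distl.
by rewrite mxE ler_distl; have := yb i; rewrite in_itv.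
Qed.

(** The function exp (- 1 / (r^2 - |x - a|^2)), normalized at a, with |.| the
Euclidean norm; it vanishes outside a box, which is a ball for the norm of the
space of columns. *)
Lemma smooth_bump d (a : 'cV[R]_d) (A : set 'cV[R]_d) : open A -> A a ->
  exists (chi : 'cV[R]_d -> R) (K : set 'cV[R]_d),
    [/\ compact K, K `<=` A, chi a = 1, smooth setT chi &
        forall x, ~ K x -> chi x = 0].
Proof.
move=> Aop Aa.
have [e /= e0 eA] := (nbhs_ballP _ _).1 (open_nbhs_nbhs (conj Aop Aa)).
pose r := e / 2.
have r0 : 0 < r by rewrite divr_gt0.
pose q (x : 'cV[R]_d) : R := r ^+ 2 - ((x - a)^T *m (x - a)) 0 0.
have qE x : q x = r ^+ 2 - \sum_i (x i 0 - a i 0) ^+ 2.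
  rewrite /q mxE; congr (_ - _); apply: eq_bigr => i _.
  by rewrite !mxE -expr2.
have smq : smooth setT q.
  move=> k; apply: Ck_add; [exact: openT|exact: Ck_cst|].
  rewrite (_ : (fun x => _) =
      fun x : 'cV[R]_d => ((- (x - a))^T *m (x - a)) 0 0).
    have sub : Ck k setT (fun x : 'cV[R]_d => x - a).
      by apply: Ck_add; [exact: openT|exact: Ck_id|exact: Ck_cst].
    apply: Ck_coord; first exact: openT.
    apply: Ck_mulmx => //; first exact: openT.
    apply: (Ck_linear (L := fun x : 'cV[R]_d => (- x)^T)) sub => //.
    - exact: openT.
    - by move=> c x y; apply/matrixP => i j; rewrite !mxE opprD mulrN.
    move=> x; apply: cvg_mx => i j.
    rewrite (_ : (fun _ => _) = fun y : 'cV[R]_d => - y j i).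
      by apply: continuousN; exact: coord_continuous.
    by apply/funext => y; rewrite !mxE.
  by apply/funext => x; rewrite linearN/= mulNmx [RHS]mxE.
have qa : 0 < q a.
  by rewrite qE big1 ?subr0 ?exprn_gt0// => i _; rewrite subrr expr0n.
have fa : flat 1 (q a) != 0.
  by rewrite /flat qa hornerE mul1r gt_eqF// expR_gt0.
exists (fun x => (flat 1 (q a))^-1 * flat 1 (q x)).
exists [set x : 'cV[R]_d | forall i, `|x i 0 - a i 0| <= r]; split.
- exact: box_compact.
- move=> x /= xb; apply: eA; rewrite -ball_normE/= distrC.
  apply: (@le_lt_trans _ _ r); last by rewrite /r ltr_pdivrMr// ltr_pMr// ltr1n.
  rewrite [leLHS]/Num.Def.normr/= mx_normrE.
  rewrite (bigmax_le _ (ltW r0))//= => -[i j] _.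
  by rewrite !mxE/= ord1.
- by rewrite mulVf.
- move=> k; apply: (Ck_bilinear (b := @GRing.mul R)).
  + exact: openT.
  + exact: mul_continuous.
  + exact: Ck_cst.
  + by apply: Ck_flat; [exact: openT|exact: smq].
- move=> x /existsNP[i /negP xi].
  suff qx : q x <= 0 by rewrite [flat 1 (q x)]/flat ltNge qx mulr0.
  rewrite qE subr_le0 (bigD1 i)//=.
  apply: (@le_trans _ _ ((x i 0 - a i 0) ^+ 2)).
    rewrite -[leRHS]real_normK ?num_real// ler_sqr ?nnegrE ?(ltW r0)//.
    by rewrite ltW// ltNge.
  by rewrite lerDl; apply: sumr_ge0 => j _; exact: sqr_ge0.
Qed.

End Bump.

(** * Jacobians in charts *)

Section Jacobian.
Variable R : realType.

Lemma jacE d e (f : 'cV[R]_d -> 'cV[R]_e) (x v : 'cV[R]_d) :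
  differentiable f x -> jac f x *m v = 'D_v f x.
Proof.
move=> df; rewrite (diff_basis v df); apply/colP => i.
rewrite mxE summxE; apply: eq_bigr => j _.
by rewrite !mxE mulrC deriveE.
Qed.

Lemma mulmx_inj_cV d e (A B : 'M[R]_(e, d)) :
  (forall v : 'cV[R]_d, A *m v = B *m v) -> A = B.
Proof.
move=> AB; apply/matrixP => i j.
by have /colP/(_ i) := AB (delta_mx j 0); rewrite -!colE !mxE.
Qed.

Lemma jac_near d e (f g : 'cV[R]_d -> 'cV[R]_e) (x : 'cV[R]_d) :
  (\near x, f x = g x) -> differentiable f x -> jac f x = jac g x.
Proof.
move=> fg df; have [dg _] := near_eq_is_diff fg df.
apply: mulmx_inj_cV => v.
apply: etrans (jacE v df) (etrans _ (esym (jacE v dg))).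
exact: near_eq_derive.
Qed.

Lemma jac_comp d e k (f : 'cV[R]_d -> 'cV[R]_e) (g : 'cV[R]_e -> 'cV[R]_k)
    (x : 'cV[R]_d) :
  differentiable f x -> differentiable g (f x) ->
  jac (fun y => g (f y)) x = jac g (f x) *m jac f x.
Proof.
move=> df dg; apply: mulmx_inj_cV => v.
apply: etrans (jacE v (differentiable_comp df dg)) _.
apply: etrans (derive_comp v df dg) _.
rewrite -mulmxA; apply: etrans (esym (jacE _ dg)) _.
by congr (_ *m _); exact: (esym (jacE v df)).
Qed.

End Jacobian.

Section Charts.
Variable R : realType.

Lemma chart_img_open (T : topologicalType) d (c : chart R T d) (B : set T) :
  open B -> open (c @` (cdom c `&` B)).
Proof.
move=> Bop; rewrite openE => _ [p [cp Bp] <-].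
have nI : nbhs (c p) (c @` cdom c).
  by apply: open_nbhs_nbhs; split; [exact: cimg_open|exists p].
have nB : nbhs (c p) (cinv c @^-1` B).
  apply: cinv_continuous; first by exists p.
  by rewrite cfunK//; apply: open_nbhs_nbhs; split.
apply: filterS (filterI nI nB) => _ [[q cq <-]].
by rewrite /= cfunK// => Bq; exists q.
Qed.

Lemma near_chart (T : topologicalType) d (c : chart R T d) (p : T)
    (P : set T) :
  cdom c p -> nbhs p P ->
  \forall x \near c p, exists2 q, (cdom c q /\ P q) & c q = x.
Proof.
move=> cp; rewrite nbhsE => -[B [Bop Bp] BP].
have nI : nbhs (c p) (c @` (cdom c `&` B)).
  by apply: open_nbhs_nbhs; split; [exact: chart_img_open|exists p].
apply: filterS nI => _ [q [cq Bq] <-]; exists q => //; split => //; exact: BP.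
Qed.

Lemma near_cimg (T : topologicalType) d (c : chart R T d) (p : T)
    (P : set 'cV[R]_d) : cdom c p ->
  (forall q, cdom c q -> P (c q)) -> \forall x \near c p, P x.
Proof.
move=> cp cP; have nA : nbhs (c p) (cimg c).
  by apply: open_nbhs_nbhs; split; [exact: cimg_open|exists p].
by apply: filterS nA => _ [q cq <-]; exact: cP.
Qed.

(** For the identity map this is a change of frame; [frame_to], [frame_from]
and [dmap] are special cases. *)
Definition chart_jac d e (M : manifold R d) (N : manifold R e) (phi : M -> N)
    (c : chart R M d) (c' : chart R N e) (p : M) : 'M[R]_(e, d) :=
  jac (fun x => c' (phi (cinv c x))) (c p).

Lemma smooth_map_id d (M : manifold R d) : smooth_map (fun p : M => p).
Proof.
split; first by move=> p; exact: cvg_id.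
by move=> c c' ac ac'; exact: transition_smooth.
Qed.

Lemma chart_expr_differentiable d e (M : manifold R d) (N : manifold R e)
    (phi : M -> N) (c : chart R M d) (c' : chart R N e) (p : M) :
  smooth_map phi -> atlas c -> atlas c' -> cdom c p -> cdom c' (phi p) ->
  differentiable (fun x => c' (phi (cinv c x))) (c p).
Proof.
by move=> [_ sphi] ac ac' cp c'p; apply: (sphi c c' ac ac' 1%N).1; exists p.
Qed.

(** The chain rule. The compatibilities between frames and differentials below
are deduced from it. *)
Lemma chart_jac_comp d e k (M : manifold R d) (N : manifold R e)
    (P : manifold R k) (phi : M -> N) (psi : N -> P) c c' c'' p :
  smooth_map phi -> smooth_map psi ->
  atlas c -> atlas c' -> atlas c'' ->
  cdom c p -> cdom c' (phi p) -> cdom c'' (psi (phi p)) ->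
  chart_jac (fun q => psi (phi q)) c c'' p
  = chart_jac psi c' c'' (phi p) *m chart_jac phi c c' p.
Proof.
move=> sphi spsi ac ac' ac'' cp c'p c''p.
have d1 := chart_expr_differentiable sphi ac ac' cp c'p.
have d2 := chart_expr_differentiable spsi ac' ac'' c'p c''p.
have e1 : c' (phi (cinv c (c p))) = c' (phi p) by rewrite cfunK.
rewrite /chart_jac -e1 in d2 *.
rewrite -(jac_comp d1 d2); apply/esym/jac_near.
  2: exact: (differentiable_comp d1 d2).
have nc' : nbhs p (phi @^-1` cdom c').
  by apply: sphi.1; apply: open_nbhs_nbhs; split => //; exact: cdom_open.
apply: filterS (near_chart cp nc') => _ [q [cq c'q] <-].
by rewrite [cinv c' _]cfunK// cfunK.
Qed.

Lemma chart_jac_id d (M : manifold R d) (c : chart R M d) p :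
  atlas c -> cdom c p -> chart_jac (fun q : M => q) c c p = 1%:M.
Proof.
move=> ac cp; apply: mulmx_inj_cV => v; rewrite mul1mx jacE; last first.
  exact: (chart_expr_differentiable (@smooth_map_id d M)).
rewrite -[RHS](derive_id (c p)); apply: near_eq_derive.
have nc : nbhs p (cdom c).
  by apply: open_nbhs_nbhs; split => //; exact: cdom_open.
by apply: filterS (near_chart cp nc) => _ [q [cq _] <-]; rewrite cfunK.
Qed.

Section Frames.
Variables (d : nat) (M : manifold R d).
Implicit Types (c : chart R M d) (p : M).

Lemma frame_toK c p : atlas c -> cdom c p ->
  frame_to c p *m frame_from c p = 1%:M.
Proof.
move=> ac cp; rewrite -(chart_jac_id ac cp).
by rewrite (chart_jac_comp (@smooth_map_id _ M) (@smooth_map_id _ M) ac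
  (chart_at_atlas p) ac cp (chart_at_dom p) cp).
Qed.

Lemma frame_fromK c p : atlas c -> cdom c p ->
  frame_from c p *m frame_to c p = 1%:M.
Proof. by move=> ac cp; apply: mulmx1C; exact: frame_toK. Qed.

Lemma frame_to_self p : frame_to (chart_at p) p = 1%:M.
Proof. exact: (chart_jac_id (chart_at_atlas p) (chart_at_dom p)). Qed.

Lemma frame_from_self p : frame_from (chart_at p) p = 1%:M.
Proof. exact: (chart_jac_id (chart_at_atlas p) (chart_at_dom p)). Qed.

Lemma loc_vfE (Y : M -> 'cV[R]_d) c p : cdom c p ->
  loc_vf Y c (c p) = frame_to c p *m Y p.
Proof. by move=> cp; rewrite /loc_vf/= cfunK. Qed.

Lemma loc_endE (A : M -> 'M[R]_d) c p : cdom c p ->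
  loc_end A c (c p) = frame_to c p *m A p *m frame_from c p.
Proof. by move=> cp; rewrite /loc_end/= cfunK. Qed.

Lemma loc_end_self (A : M -> 'M[R]_d) p :
  loc_end A (chart_at p) (origin p) = A p.
Proof.
rewrite (loc_endE A (chart_at_dom p)) frame_to_self frame_from_self.
by rewrite mul1mx mulmx1.
Qed.

End Frames.

(** Changing frames at both ends turns the differential in the distinguished
frames at p and phi p into the differential in arbitrary charts. *)
Lemma chart_jacE d e (M : manifold R d) (N : manifold R e) (phi : M -> N)
    c c' p :
  smooth_map phi -> atlas c -> atlas c' -> cdom c p -> cdom c' (phi p) ->
  chart_jac phi c c' p = frame_to c' (phi p) *m dmap phi p *m frame_from c p.
Proof.
move=> sphi ac ac' cp c'p.
rewrite (chart_jac_comp (phi := fun q => q) (psi := phi) (c' := chart_at p))//;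
  [|exact: smooth_map_id|exact: chart_at_atlas|exact: chart_at_dom].
congr (_ *m _).
rewrite (chart_jac_comp (phi := phi) (psi := fun q => q)
  (c' := chart_at (phi p)))//;
  [exact: smooth_map_id|exact: chart_at_atlas|exact: chart_at_atlas
  |exact: chart_at_dom|exact: chart_at_dom].
Qed.

End Charts.

(** * The Levi-Civita connection in coordinates *)

Section Connection.
Variables (R : realType) (d : nat) (M : manifold R d) (g : riemannian M).
Implicit Types (p : M) (X Y u v w : 'cV[R]_d).

Lemma cimg_origin p : cimg (chart_at p) (origin p).
Proof. by exists p => //; exact: chart_at_dom. Qed.

Definition metric_comp p u v (x : 'cV[R]_d) : R :=
  (u^T *m loc_form g (chart_at p) x *m v) 0 0.

Lemma metric_comp_differentiable p u v :
  differentiable (metric_comp p u v) (origin p).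
Proof.
have dg : differentiable (loc_form g (chart_at p)) (origin p).
  exact: (metric_smooth g (chart_at_atlas p) 1%N).1 (cimg_origin p).
apply: coord_differentiable; apply: mulmx_differentiable; last first.
  exact: differentiable_cst.
by apply: mulmx_differentiable => //; exact: differentiable_cst.
Qed.

Lemma metric_comp_sym p u v : metric_comp p u v = metric_comp p v u.
Proof.
apply/funext => x; rewrite /metric_comp.
have sg : (loc_form g (chart_at p) x)^T = loc_form g (chart_at p) x.
  by rewrite /loc_form/= !trmx_mul trmxK Defs.metric_sym mulmxA.
move: (loc_form g (chart_at p) x) sg => G sg.
suff -> : u^T *m G *m v = (v^T *m G *m u)^T by rewrite mxE.
by rewrite !trmx_mul trmxK sg mulmxA.
Qed.

Lemma metric_comp_linear p a u u' v x :
  metric_comp p (a *: u + u') v x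
  = a * metric_comp p u v x + metric_comp p u' v x.
Proof. by rewrite /metric_comp linearP/= !mulmxDl -!scalemxAl !mxE. Qed.

Lemma derive_metric_comp p a u u' v w :
  'D_w (metric_comp p (a *: u + u') v) (origin p) =
  a * 'D_w (metric_comp p u v) (origin p)
  + 'D_w (metric_comp p u' v) (origin p).
Proof.
have d1 : derivable (metric_comp p u v) (origin p) w.
  by apply: diff_derivable; exact: metric_comp_differentiable.
have d2 : derivable (metric_comp p u' v) (origin p) w.
  by apply: diff_derivable; exact: metric_comp_differentiable.
have -> : metric_comp p (a *: u + u') v
    = (a *: metric_comp p u v) + metric_comp p u' v.
  by apply/funext => x; exact: metric_comp_linear.
apply: etrans (deriveD (derivableZ d1) d2) _.
by congr (_ + _); exact: deriveZ.
Qed.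

Lemma christoffelE p X Y : christoffel_at g p X Y =
  invmx (loc_form g (chart_at p) (origin p)) *m
  \col_l (2^-1 * ('D_X (metric_comp p Y (delta_mx l 0)) (origin p)
                  + 'D_Y (metric_comp p X (delta_mx l 0)) (origin p)
                  - 'D_(delta_mx l 0) (metric_comp p X Y) (origin p))).
Proof. by []. Qed.

Lemma christoffel_sym p X Y : christoffel_at g p X Y = christoffel_at g p Y X.
Proof.
rewrite !christoffelE; congr (_ *m _); apply/colP => l; rewrite !mxE.
have swap (a b z z' : R) : z = z' -> 2^-1 * (a + b - z) = 2^-1 * (b + a - z').
  by move=> ->; rewrite [a + b]addrC.
exact: swap
  (congr1 (fun f => 'D_(delta_mx l 0) f (origin p)) (metric_comp_sym p X Y)).
Qed.

(** The Christoffel vector is built from directional derivatives of the metric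
coefficients; as these are differentiable, the derivatives are linear in the
direction. *)
Lemma christoffel_linear p X : linear (christoffel_at g p X).
Proof.
move=> a Y Z; rewrite !christoffelE scalemxAr -mulmxDr; congr (_ *m _).
apply/colP => l; rewrite !mxE.
have dg := metric_comp_differentiable.
have e1 : 'D_X (metric_comp p (a *: Y + Z) (delta_mx l 0)) (origin p) =
    a * 'D_X (metric_comp p Y (delta_mx l 0)) (origin p)
    + 'D_X (metric_comp p Z (delta_mx l 0)) (origin p).
  exact: derive_metric_comp.
have e2 : 'D_(a *: Y + Z) (metric_comp p X (delta_mx l 0)) (origin p) =
    a * 'D_Y (metric_comp p X (delta_mx l 0)) (origin p)
    + 'D_Z (metric_comp p X (delta_mx l 0)) (origin p).
  by rewrite (derive_dirD _ _ (dg p _ _)) (derive_dirZ _ _ (dg p _ _)).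
have e3 : 'D_(delta_mx l 0) (metric_comp p X (a *: Y + Z)) (origin p) =
    a * 'D_(delta_mx l 0) (metric_comp p X Y) (origin p)
    + 'D_(delta_mx l 0) (metric_comp p X Z) (origin p).
  by rewrite ![metric_comp p X _]metric_comp_sym; exact: derive_metric_comp.
have lin (z1 z2 z3 x1 x2 x3 y1 y2 y3 : R) :
    z1 = a * x1 + y1 -> z2 = a * x2 + y2 -> z3 = a * x3 + y3 ->
    2^-1 * (z1 + z2 - z3) = a * (2^-1 * (x1 + x2 - x3)) + 2^-1 * (y1 + y2 - y3).
  by move=> -> -> ->; ring.
exact: lin e1 e2 e3.
Qed.

Definition christoffel_mx p X : 'M[R]_d :=
  \matrix_(i, j) (christoffel_at g p X (delta_mx j 0)) i 0.

Lemma christoffel_mxE p X Y : christoffel_at g p X Y = christoffel_mx p X *m Y.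
Proof.
pose aL := GRing.isLinear.Build _ _ _ _ _ (christoffel_linear p X).
pose L : {linear 'cV[R]_d -> 'cV[R]_d} := HB.pack (christoffel_at g p X) aL.
have -> : christoffel_at g p X Y = L Y by [].
have -> : Y = \sum_j Y j 0 *: delta_mx j 0.
  apply/colP => i; rewrite summxE (bigD1 i)//= !mxE !eqxx mulr1 big1 ?addr0//.
  by move=> j ji; rewrite !mxE eq_sym (negPf ji) mulr0.
rewrite linear_sum mulmx_sumr; apply: eq_bigr => j _.
rewrite linearZ -scalemxAr/= -colE; congr (_ *: _).
by apply/colP => i; rewrite !mxE.
Qed.

Lemma christoffel_mx_sym p X Y :
  christoffel_mx p X *m Y = christoffel_mx p Y *m X.
Proof.
apply: etrans (esym (christoffel_mxE p X Y)) _.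
exact: etrans (christoffel_sym p X Y) (christoffel_mxE p Y X).
Qed.

Lemma nablaE p X (Y : M -> 'cV[R]_d) : nabla g p X Y =
  'D_X (loc_vf Y (chart_at p)) (origin p) + christoffel_mx p X *m Y p.
Proof. by rewrite /nabla christoffel_mxE. Qed.

Lemma nabla_endE p X (S : M -> 'M[R]_d) : nabla_end g p X S =
  'D_X (loc_end S (chart_at p)) (origin p)
  + (christoffel_mx p X *m S p - S p *m christoffel_mx p X).
Proof. by []. Qed.

End Connection.

(** * Complex tangent vectors and extension of vector fields *)

Section ComplexVectors.
Variable R : realType.

Definition cvec_of d (u v : 'cV[R]_d) : 'cV[R[i]]_d :=
  \col_i (Complex (u i 0) (v i 0)).

Lemma remx_cvec_of d (u v : 'cV[R]_d) : remx (cvec_of u v) = u.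
Proof. by apply/colP => i; rewrite !mxE. Qed.

Lemma immx_cvec_of d (u v : 'cV[R]_d) : immx (cvec_of u v) = v.
Proof. by apply/colP => i; rewrite !mxE. Qed.

Lemma cmxM m k d (A : 'M[R]_(m, k)) (B : 'M[R]_(k, d)) :
  cmx (A *m B) = cmx A *m cmx B.
Proof. exact: map_mxM. Qed.

Lemma cmx_tr k d (A : 'M[R]_(k, d)) : cmx A^T = (cmx A)^T.
Proof. by apply/matrixP => i j; rewrite !mxE. Qed.

Lemma cmx_eqP k d (A B : 'M[R[i]]_(k, d)) :
  remx A = remx B -> immx A = immx B -> A = B.
Proof.
move=> eR eI; apply/matrixP => i j; apply/eqP; rewrite eq_complex.
have /matrixP/(_ i j) := eR; have /matrixP/(_ i j) := eI.
by rewrite !mxE => -> ->; rewrite !eqxx.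
Qed.

Lemma remx_cmxM m k d (A : 'M[R]_(m, k)) (X : 'M[R[i]]_(k, d)) :
  remx (cmx A *m X) = A *m remx X.
Proof.
apply/matrixP => i j; rewrite !mxE raddf_sum; apply: eq_bigr => l _.
by rewrite !mxE; case: (X l j) => x y /=; rewrite mul0r subr0.
Qed.

Lemma immx_cmxM m k d (A : 'M[R]_(m, k)) (X : 'M[R[i]]_(k, d)) :
  immx (cmx A *m X) = A *m immx X.
Proof.
apply/matrixP => i j; rewrite !mxE raddf_sum; apply: eq_bigr => l _.
by rewrite !mxE; case: (X l j) => x y /=; rewrite mul0r addr0.
Qed.

Lemma remx_iZ k d (X : 'M[R[i]]_(k, d)) : remx ('i%C *: X) = - immx X.
Proof.
apply/matrixP => i j; rewrite !mxE; case: (X i j) => x y /=.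
by rewrite mul0r mul1r add0r.
Qed.

Lemma immx_iZ k d (X : 'M[R[i]]_(k, d)) : immx ('i%C *: X) = remx X.
Proof.
apply/matrixP => i j; rewrite !mxE; case: (X i j) => x y /=.
by rewrite mul0r mul1r add0r.
Qed.

Lemma remxN k d (X : 'M[R[i]]_(k, d)) : remx (- X) = - remx X.
Proof. by apply/matrixP => i j; rewrite !mxE raddfN. Qed.

Lemma immxN k d (X : 'M[R[i]]_(k, d)) : immx (- X) = - immx X.
Proof. by apply/matrixP => i j; rewrite !mxE raddfN. Qed.

Lemma remx_cplx k d (A B : 'M[R]_(k, d)) : remx (cmx A + 'i%C *: cmx B) = A.
Proof.
apply/matrixP => i j; rewrite !mxE/=.
by rewrite mulr0 mul0r subrr addr0.
Qed.

Lemma immx_cplx k d (A B : 'M[R]_(k, d)) : immx (cmx A + 'i%C *: cmx B) = B.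
Proof.
apply/matrixP => i j; rewrite !mxE/=.
by rewrite mulr0 mul1r !add0r.
Qed.

Section Types.
Variables (d : nat) (M : manifold R d) (g : riemannian M).
Variable J : almost_hermitian g.

(** For real vectors a and b, J (a + i b) = i (a + i b) means J a = - b and J b
= a. *)
Lemma T10P p X : T10 J p X <->
  J p *m remx X = - immx X /\ J p *m immx X = remx X.
Proof.
split=> [XT|[e1 e2]].
  by rewrite -remx_cmxM -immx_cmxM XT remx_iZ immx_iZ.
apply: cmx_eqP; first by rewrite remx_cmxM remx_iZ.
by rewrite immx_cmxM immx_iZ.
Qed.

Lemma T01P p X : T01 J p X <->
  J p *m remx X = immx X /\ J p *m immx X = - remx X.
Proof.
split=> [XT|[e1 e2]].
  rewrite -remx_cmxM -immx_cmxM XT !scaleNr remxN immxN.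
  by rewrite remx_iZ immx_iZ opprK.
apply: cmx_eqP; rewrite !scaleNr ?remxN ?immxN.
  by rewrite remx_cmxM remx_iZ opprK.
by rewrite immx_cmxM immx_iZ.
Qed.

End Types.
End ComplexVectors.

Section Fields.
Variables (R : realType) (d : nat) (M : manifold R d).

(** Extend a by constant coordinates near p, multiply by a bump function and
extend by 0. Smoothness across the boundary of the chart domain needs a compact
set containing the support to be closed in M; this is where M is Hausdorff. *)
Lemma vf_extension (p : M) (a : 'cV[R]_d) :
  exists2 V : M -> 'cV[R]_d, smooth_vf V & V p = a.
Proof.
pose c := chart_at p.
have ac : atlas c := chart_at_atlas p.
have cp : cdom c p := chart_at_dom p.
have [chi [K [Kco KA chi1 schi chi0]]] :=
  smooth_bump (@cimg_open _ _ _ c) (ex_intro2 _ _ p cp erefl).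
pose V q := if `[< cdom c q >] then chi (c q) *: (frame_from c q *m a) else 0.
have VE q : cdom c q -> V q = chi (c q) *: (frame_from c q *m a).
  by move=> cq; rewrite /V asboolT.
exists V; last by rewrite VE// [chi _]chi1 scale1r frame_from_self mul1mx.
  move=> c' ac' k; apply: Ck_local => _ [q c'q <-].
  have [cq|ncq] := pselect (cdom c q).
    (* At points of the domain of c the field is chi times a derivative of the
       transition map. *)
    exists (c' @` (cdom c' `&` cdom c)); first by exists q.
    have op : open (c' @` (cdom c' `&` cdom c)).
      by apply: chart_img_open; exact: cdom_open.
    have op' : open (c @` (cdom c `&` cdom c')).
      by apply: chart_img_open; exact: cdom_open.
    pose G y := chi y *: 'D_a (fun x => c' (cinv c x)) y.
    have CG : Ck k (c @` (cdom c `&` cdom c')) G.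
      apply: Ck_scale => //; first by apply: Ck_subset (schi k).
      exact: (transition_smooth ac ac' k.+1).2.
    have CT := transition_smooth ac' ac k.
    apply: Ck_congr (Ck_comp op _ CT CG) => //.
      move=> _ [r [c'r cr] <-]; rewrite /G cfunK// loc_vfE// VE//.
      rewrite -scalemxAr; congr (_ *: _); rewrite mulmxA.
      rewrite -(jacE a
        (chart_expr_differentiable (@smooth_map_id _ _ M) ac ac' cr c'r)).
      congr (_ *m _).
      rewrite -/(chart_jac (fun q => q) c c' r).
      by rewrite (chart_jac_comp (@smooth_map_id _ _ M) (@smooth_map_id _ _ M)
        ac (chart_at_atlas r) ac' cr (chart_at_dom r) c'r).
    by move=> _ [r [c'r cr] <-]; exists r => //; rewrite cfunK.
  (* The other points lie in the open set off KM, where the field is 0. *)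
  pose KM := cinv c @` K.
  have KMc : closed KM.
    apply: compact_closed; first exact: carrier_hausdorff.
    apply: continuous_compact Kco.
    apply: continuous_in_subspaceT => x /[1!inE] Kx.
    by apply: cinv_continuous; exact: KA.
  have nK r : ~ KM r -> V r = 0.
    move=> nr; rewrite /V; case: asboolP => // cr.
    rewrite chi0 ?scale0r// => Kr; apply: nr; exists (c r) => //.
    exact: cfunK.
  have op : open (c' @` (cdom c' `&` ~` KM)).
    by apply: chart_img_open; exact: closed_openC.
  exists (c' @` (cdom c' `&` ~` KM)).
    exists q => //; split => //= -[x /KA[r cr rx] xq]; apply: ncq.
    by rewrite -xq -rx cfunK.
  apply: Ck_congr (Ck_cst (W := 'cV[R]_d) k _ 0) => //.
  by move=> _ [r [c'r nr] <-]; rewrite loc_vfE// nK// mulmx0.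
Qed.

Lemma smooth_vfN (V : M -> 'cV[R]_d) :
  smooth_vf V -> smooth_vf (fun q => - V q).
Proof.
move=> sV c ac k.
have C : Ck k (cimg c) (fun x => (- 1%:M) *m loc_vf V c x).
  by apply: Ck_mulmx; [exact: cimg_open|exact: Ck_cst|exact: sV].
apply: Ck_congr C; first exact: cimg_open.
by move=> x _; rewrite mulNmx mul1mx /loc_vf/= mulmxN.
Qed.

Lemma smooth_vf_end (S : M -> 'M[R]_d) (V : M -> 'cV[R]_d) :
  (forall c, atlas c -> smooth (cimg c) (loc_end S c)) ->
  smooth_vf V -> smooth_vf (fun q => S q *m V q).
Proof.
move=> sS sV c ac k.
have C : Ck k (cimg c) (fun x => loc_end S c x *m loc_vf V c x).
  by apply: Ck_mulmx; [exact: cimg_open|exact: sS|exact: sV].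
apply: Ck_congr C; first exact: cimg_open.
move=> _ [q cq <-]; rewrite loc_endE// !loc_vfE//.
move: (frame_to c q) (frame_from c q) (frame_fromK ac cq) => T F FT.
by rewrite -!mulmxA [F *m _]mulmxA FT mul1mx.
Qed.

End Fields.

(** * (1,2)-symplectic structures *)

Section Symplectic.
Variables (R : realType) (d : nat) (M : manifold R d) (g : riemannian M).
Variable J : almost_hermitian g.

Lemma loc_acs_differentiable p :
  differentiable (loc_end J (chart_at p)) (origin p).
Proof. exact: (acs_smooth J (chart_at_atlas p) 1%N).1 (cimg_origin p). Qed.

Lemma loc_acs_sqr p : \forall x \near origin p,
  loc_end J (chart_at p) x *m loc_end J (chart_at p) x = - 1%:M.
Proof.
apply: near_cimg; first exact: chart_at_dom.
move=> q cq; rewrite loc_endE//.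
move: (frame_to _ q) (frame_from _ q) (frame_fromK (chart_at_atlas p) cq)
  (frame_toK (chart_at_atlas p) cq) => T F FT TF.
rewrite -!mulmxA [F *m (T *m _)]mulmxA FT mul1mx [J q *m (J q *m _)]mulmxA.
by rewrite acs_sqr mulNmx mul1mx mulmxN TF.
Qed.

Lemma derive_acs_anti p X :
  'D_X (loc_end J (chart_at p)) (origin p) *m J p
  = - (J p *m 'D_X (loc_end J (chart_at p)) (origin p)).
Proof.
have dJ := loc_acs_differentiable p.
have e : 'D_X (fun x => loc_end J (chart_at p) x *m loc_end J (chart_at p) x)
    (origin p) = 0.
  apply: etrans (near_eq_derive X (loc_acs_sqr p)) _.
  exact: (derive_cst (- 1%:M : 'M[R]_d)).
have := etrans (esym (derive_mulmx X dJ dJ)) e.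
by rewrite loc_end_self => /eqP; rewrite addr_eq0 => /eqP.
Qed.

(** Differentiate J J = - 1; the Christoffel terms obey the same rule. *)
Lemma nabla_acs_anti p X :
  nabla_end g p X J *m J p = - (J p *m nabla_end g p X J).
Proof.
rewrite nabla_endE.
move: (derive_acs_anti p X) (acs_sqr J p) (christoffel_mx g p X) => + + G.
move: ('D_X _ _) (J p) => D I DI II.
have GII : G *m I *m I = - G by rewrite -mulmxA II mulmxN mulmx1.
have IIG : I *m (I *m G) = - G by rewrite mulmxA II mulNmx mul1mx.
rewrite mulmxDl mulmxDr mulmxBl mulmxBr DI GII IIG -mulmxA opprD opprK.
by rewrite opprD [- G - _]addrC.
Qed.

(** The Leibniz rule (nabla_X J) V = nabla_X (J V) - J (nabla_X V). *)
Lemma nabla_acsE p X (V : M -> 'cV[R]_d) : smooth_vf V ->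
  nabla g p X (fun q => J q *m V q)
  = nabla_end g p X J *m V p + J p *m nabla g p X V.
Proof.
move=> sV.
have dJ := loc_acs_differentiable p.
have dV : differentiable (loc_vf V (chart_at p)) (origin p).
  exact: (sV _ (chart_at_atlas p) 1%N).1 (cimg_origin p).
have Vp : loc_vf V (chart_at p) (origin p) = V p.
  by rewrite (loc_vfE _ (chart_at_dom p)) frame_to_self mul1mx.
have e : 'D_X (loc_vf (fun q => J q *m V q) (chart_at p)) (origin p) =
    'D_X (loc_end J (chart_at p)) (origin p) *m V p
    + J p *m 'D_X (loc_vf V (chart_at p)) (origin p).
  apply: etrans (near_eq_derive X _) _; last first.
    by apply: etrans (derive_mulmx X dJ dV) _; rewrite loc_end_self Vp.
  apply: near_cimg; first exact: chart_at_dom.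
  move=> q cq; rewrite loc_endE// !loc_vfE//.
  move: (frame_to _ q) (frame_from _ q) (frame_fromK (chart_at_atlas p) cq).
  move=> T F FT.
  by rewrite -!mulmxA [F *m _]mulmxA FT mul1mx.
apply: etrans (nablaE _ _ _ _) _; rewrite nablaE nabla_endE.
apply: etrans (congr1 (fun z => z + _) e) _.
move: ('D_X (loc_end _ _) _) ('D_X (loc_vf _ _) _).
move: (J p) (V p) (christoffel_mx g p X).
move=> I v G D W; rewrite !mulmxDl mulmxDr mulNmx !mulmxA.
move: (D *m v) (I *m W) (G *m I *m v) (I *m G *m v) => x y z w.
by apply/colP => i; rewrite !mxE; ring.
Qed.

Lemma nablaN p X (V : M -> 'cV[R]_d) : smooth_vf V ->
  nabla g p X (fun q => - V q) = - nabla g p X V.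
Proof.
move=> sV.
have dV : differentiable (loc_vf V (chart_at p)) (origin p).
  exact: (sV _ (chart_at_atlas p) 1%N).1 (cimg_origin p).
have Vn : loc_vf (fun q => - V q) (chart_at p) = - loc_vf V (chart_at p).
  by apply/funext => x; exact: mulmxN.
rewrite !nablaE Vn opprD mulmxN; congr (_ + _).
by apply: deriveN; exact: diff_derivable.
Qed.

(** For real fields W and V, apply the condition to Z = W + i J W, which has
type (0,1), and Y = V - i J V, which has type (1,0). The imaginary part of the
statement that nabla_Z Y is an i-eigenvector of J, expanded with [nabla_acsE],
is the claim for u = W p applied to a = V p. *)
Lemma symplectic12_nabla_acs p u : symplectic12 J ->
  nabla_end g p (J p *m u) J = - (J p *m nabla_end g p u J).
Proof.
move=> hM; apply: mulmx_inj_cV => a.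
have [V sV Vp] := vf_extension p a.
have [W sW Wp] := vf_extension p u.
have sJV := smooth_vf_end (acs_smooth J) sV.
have sJW := smooth_vf_end (acs_smooth J) sW.
pose Z q := cvec_of (W q) (J q *m W q).
pose Y q := cvec_of (V q) (- (J q *m V q)).
have JJ q (v : 'cV[R]_d) : J q *m (J q *m v) = - v.
  by rewrite mulmxA acs_sqr mulNmx mul1mx.
have ReZ : (fun q => remx (Z q)) = W by apply/funext => q; exact: remx_cvec_of.
have ImZ : (fun q => immx (Z q)) = fun q => J q *m W q.
  by apply/funext => q; exact: immx_cvec_of.
have ReY : (fun q => remx (Y q)) = V by apply/funext => q; exact: remx_cvec_of.
have ImY : (fun q => immx (Y q)) = fun q => - (J q *m V q).
  by apply/funext => q; exact: immx_cvec_of.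
have := hM Z Y.
have sZ : smooth_cvf Z by split; rewrite ?ReZ ?ImZ.
have sY : smooth_cvf Y by split; rewrite ?ReY ?ImY//; exact: smooth_vfN.
have tZ q : T01 J q (Z q).
  by apply/T01P; rewrite remx_cvec_of immx_cvec_of; split => //; exact: JJ.
have tY q : T10 J q (Y q).
  by apply/T10P; rewrite remx_cvec_of immx_cvec_of mulmxN JJ !opprK.
(* As J J = - 1, the relation J (Im) = Re is the whole condition. *)
move=> /(_ sZ tZ sY tY p) /T10P[_].
rewrite /cnabla ReY ImY remx_cvec_of immx_cvec_of /cbilin remx_cplx immx_cplx.
rewrite !nablaN// !nabla_acsE// Vp Wp.
move: (nabla_end g p u J) (nabla_end g p (J p *m u) J) => D DJ.
move: (nabla g p u V) (nabla g p (J p *m u) V) => n1 n2.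
rewrite mulmxDr mulmxN !mulmxDr !mulmxA acs_sqr !mulNmx !mul1mx => e.
move: (J p *m D *m a) (DJ *m a) (J p *m n2) e => x y w.
by rewrite opprB opprK addrA => /addIr/addrI.
Qed.

End Symplectic.

(** * The second fundamental form in coordinates *)

Section SecondForm.
Variables (R : realType) (d e : nat) (M : manifold R d) (g : riemannian M)
  (N : manifold R e) (h : riemannian N) (phi : M -> N).
Hypothesis sphi : smooth_map phi.
Implicit Types (p : M) (X Y : 'cV[R]_d).

Lemma near_loc_map p (P : set 'cV[R]_d) :
  (forall q, cdom (chart_at p) q -> cdom (chart_at (phi p)) (phi q) ->
     P (chart_at p q)) -> \forall x \near origin p, P x.
Proof.
move=> H.
have nc' : nbhs p (phi @^-1` cdom (chart_at (phi p))).
  apply: sphi.1; apply: open_nbhs_nbhs; split; last exact: chart_at_dom.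
  exact: cdom_open.
apply: filterS (near_chart (chart_at_dom p) nc') => _ [q [cq c'q] <-].
exact: H.
Qed.

Lemma loc_map_smooth p :
  exists A : set 'cV[R]_d, [/\ open A, A (origin p) & smooth A (loc_map phi p)].
Proof.
exists
  (chart_at p @` (cdom (chart_at p) `&` phi @^-1` cdom (chart_at (phi p)))).
split.
- apply: chart_img_open; apply: open_comp; last exact: cdom_open.
  by move=> q _; exact: sphi.1.
- by exists p => //; split; exact: chart_at_dom.
- exact: (sphi.2 _ _ (chart_at_atlas p) (chart_at_atlas (phi p))).
Qed.

(** To prove a property of all points near the origin of the chart it suffices
to treat images of points q of M, where the Jacobian of phi can be expressed
through the intrinsic differential of phi at q. *)
Lemma near_jac_loc_map p (P : set 'cV[R]_d) :
  (forall q, cdom (chart_at p) q -> cdom (chart_at (phi p)) (phi q) ->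
     jac (loc_map phi p) (chart_at p q) = frame_to (chart_at (phi p)) (phi q)
       *m dmap phi q *m frame_from (chart_at p) q ->
     (forall Y, jac (loc_map phi p) (chart_at p q) *m Y
        = 'D_Y (loc_map phi p) (chart_at p q)) ->
     P (chart_at p q)) -> \forall x \near origin p, P x.
Proof.
move=> H; apply: near_loc_map => q cq c'q; apply: H => //.
  exact: (chart_jacE sphi (chart_at_atlas p) (chart_at_atlas (phi p)) cq c'q).
move=> Y; apply: jacE.
exact: (chart_expr_differentiable sphi (chart_at_atlas p)
  (chart_at_atlas (phi p)) cq c'q).
Qed.

Lemma coord_field_self p Y : coord_field p Y p = Y.
Proof. by rewrite /coord_field frame_from_self mul1mx. Qed.

(** The field has constant coordinates in this chart, so only the Christoffel
term survives. *)
Lemma nabla_coord_field p X Y :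
  nabla g p X (coord_field p Y) = christoffel_mx g p X *m Y.
Proof.
apply: etrans (nablaE _ _ _ _) _; rewrite coord_field_self.
have e0 : 'D_X (loc_vf (coord_field p Y) (chart_at p)) (origin p) = 0.
  apply: etrans (near_eq_derive X _) (derive_cst Y X (origin p)).
  apply: near_cimg; first exact: chart_at_dom.
  move=> q cq; rewrite loc_vfE// /coord_field mulmxA.
  by move: (frame_toK (chart_at_atlas p) cq) => ->; rewrite mul1mx.
exact: etrans (congr1 (fun z => z + _) e0) (add0r _).
Qed.

Lemma second_formE p X Y : second_form g h phi p X Y =
  'D_X ('D_Y (loc_map phi p)) (origin p)
  + christoffel_mx h (phi p) (dmap phi p *m X) *m (dmap phi p *m Y)
  - dmap phi p *m (christoffel_mx g p X *m Y).
Proof.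
rewrite /second_form nabla_coord_field; congr (_ - _).
rewrite /nabla_pullback coord_field_self christoffel_mxE; congr (_ + _).
apply: near_eq_derive; apply: near_jac_loc_map => q cq c'q eq DY.
rewrite -DY eq/= cfunK// /coord_field.
by rewrite !mulmxA.
Qed.

(** The second derivatives are symmetric by [Schwarz], and both connections are
torsion-free. *)
Lemma second_form_sym p X Y :
  second_form g h phi p X Y = second_form g h phi p Y X.
Proof.
have [A [Aop Ap C]] := loc_map_smooth p.
apply: etrans (second_formE p X Y) (etrans _ (esym (second_formE p Y X))).
have e1 := Schwarz X Y Aop Ap (C 2%N).
have e2 := christoffel_mx_sym h (phi p) (dmap phi p *m X) (dmap phi p *m Y).
have e3 := christoffel_mx_sym g p X Y.
have key (a a' b b' c c' : 'cV[R]_e) :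
    a = a' -> b = b' -> c = c' -> a + b - c = a' + b' - c'.
  by move=> -> -> ->.
exact: key e1 e2 (congr1 (mulmx (dmap phi p)) e3).
Qed.

(** The columns of the Jacobian are the partial derivatives, hence
differentiable. The second part makes the second derivative linear in Y and
lets the product rule for matrices be applied to dphi. *)
Lemma jac_loc_map_differentiable p :
  differentiable (jac (loc_map phi p)) (origin p) /\
  forall X Y, 'D_X (jac (loc_map phi p)) (origin p) *m Y
              = 'D_X ('D_Y (loc_map phi p)) (origin p).
Proof.
have [A [Aop Ap C]] := loc_map_smooth p.
have [dF DF] := C 2%N.
pose G (x : 'cV[R]_d) : 'M[R]_(e, d) :=
  \sum_j 'D_(delta_mx j 0) (loc_map phi p) x *m (delta_mx 0 j : 'rV_d).
have nA : nbhs (origin p) A by apply: open_nbhs_nbhs.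
have GE x : A x -> G x = jac (loc_map phi p) x.
  move=> Ax; apply: mulmx_inj_cV => v.
  apply: etrans (esym (etrans (jacE v (dF x Ax)) (diff_basis v (dF x Ax)))).
  rewrite /G mulmx_suml; apply: eq_bigr => j _; rewrite -mulmxA -rowE.
  by apply/colP => i; rewrite !mxE big_ord1 !mxE mulrC.
have CG : Ck 1 A G.
  apply: Ck_sum => // j; apply: Ck_mulmx => //; last exact: Ck_cst.
have dj : differentiable (jac (loc_map phi p)) (origin p).
  have [//] := near_eq_is_diff (filterS GE nA) (CG.1 _ Ap).
split=> // X Y.
apply: etrans (esym (derive_mulmxr Y X dj)) _.
apply: near_eq_derive; apply: filterS nA => x Ax; exact: (jacE Y (dF x Ax)).
Qed.

Lemma second_formN p X Y :
  second_form g h phi p X (- Y) = - second_form g h phi p X Y.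
Proof.
have [_ jE] := jac_loc_map_differentiable p.
have eN : 'D_X ('D_(- Y) (loc_map phi p)) (origin p) =
    - 'D_X ('D_Y (loc_map phi p)) (origin p).
  apply: etrans (esym (jE X (- Y))) _.
  by rewrite mulmxN; congr (- _); exact: jE.
apply: etrans (second_formE p X (- Y)) _.
apply: etrans _ (congr1 -%R (esym (second_formE p X Y))).
have key (a a' b c : 'cV[R]_e) : a' = - a -> a' + - b - - c = - (a + b - c).
  by move=> ->; rewrite !opprD.
by rewrite !mulmxN; exact: key.
Qed.

End SecondForm.

(** * Holomorphic maps into the twistor space *)

Section Algebra.
Variables (R : realType) (d e : nat).

(** The derivative of A L = L I in coordinates, after adding the Christoffel
terms G of the source and G' of the target that turn ordinary derivatives into
covariant ones: L stands for dphi, I for J, A for S, and H, HI for second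
derivatives of phi. *)
Lemma leibniz_with_connections (L : 'M[R]_(e, d)) (A dA G' : 'M[R]_e)
    (I dI G : 'M[R]_d) (Y : 'cV[R]_d) (H HI : 'cV[R]_e) :
  dA *m (L *m Y) + A *m H = HI + L *m (dI *m Y) ->
  (forall v : 'cV[R]_d, A *m (L *m v) = L *m (I *m v)) ->
  HI + G' *m (L *m (I *m Y)) - L *m (G *m (I *m Y))
    + L *m ((dI + (G *m I - I *m G)) *m Y)
  = (dA + (G' *m A - A *m G')) *m (L *m Y)
    + A *m (H + G' *m (L *m Y) - L *m (G *m Y)).
Proof.
move=> e1 AL; have -> : HI = dA *m (L *m Y) + A *m H - L *m (dI *m Y).
  by rewrite e1 addrK.
rewrite !(mulmxDl, mulmxDr, mulNmx, mulmxN) -!mulmxA !AL.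
move: (dA *m _) (A *m H) (L *m (I *m (G *m _))) (L *m (dI *m Y))
  (L *m (G *m _)) (G' *m _) (A *m (G' *m _)) => a b z c y x w.
by apply/colP => i; rewrite !mxE; ring.
Qed.

Lemma bilinear_form_eq (A B : 'M[R]_d) :
  (forall u v : 'cV[R]_d, (u^T *m A *m v) 0 0 = (u^T *m B *m v) 0 0) -> A = B.
Proof.
move=> AB; apply/matrixP => i j.
have := AB (delta_mx i 0) (delta_mx j 0).
by rewrite -!mulmxA -!colE trmx_delta -!rowE !mxE.
Qed.

End Algebra.

Section EndMaps.
Variables (R : realType) (d e : nat) (M : manifold R d) (N : manifold R e).
Variables (s : M -> N * 'M[R]_e) (U : set M).
Hypothesis smooth_s : smooth_to_end U s.

Lemma smooth_to_end_differentiable p : U p ->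
  differentiable
    (fun x => end_chart (chart_at (s p).1) (s (cinv (chart_at p) x)))
    (origin p).
Proof.
move=> Up; apply: (smooth_s.2 _ _ (chart_at_atlas p) (chart_at_atlas _) 1%N).1.
by exists p => //; split; [split => //|]; exact: chart_at_dom.
Qed.

Lemma dmap_end1 p X : U p -> (dmap_end s p X).1 =
  'D_X (fun x => chart_at (s p).1 (s (cinv (chart_at p) x)).1) (origin p).
Proof.
move=> Up; have dP := smooth_to_end_differentiable Up.
rewrite /dmap_end -(deriveE X dP); apply/esym.
apply: (derive_linear X (L := fst)) dP; first by [].
by move=> z; exact: cvg_fst.
Qed.

Lemma dmap_end2 p X : U p -> (dmap_end s p X).2 =
  'D_X (fun x => (end_chart (chart_at (s p).1) (s (cinv (chart_at p) x))).2)
    (origin p).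
Proof.
move=> Up; have dP := smooth_to_end_differentiable Up.
rewrite /dmap_end -(deriveE X dP); apply/esym.
apply: (derive_linear X (L := snd)) dP; first by [].
by move=> z; exact: cvg_snd.
Qed.

End EndMaps.

Section Twistor.
Variables (R : realType) (n : nat) (N : manifold R n.*2) (h : riemannian N).
Variable o : orientation N.

(** A horizontal vector is tangent to a section that is parallel in its
direction, so its fibre component is minus the Christoffel term. *)
Lemma horizontal_fibre (z : twistor h o) w : horizontal z w ->
  w.2 = - (christoffel_mx h (tw_pi z) w.1 *m tw_J z
           - tw_J z *m christoffel_mx h (tw_pi z) w.1).
Proof.
move=> [U [sigma [X [[Uop Uz] [_ ssig] <- nab ->]]]].
have e1 := dmap_end1 ssig X Uz.
have e2 := dmap_end2 ssig X Uz.
have {}e1 : (dmap_end (fun y => (y, sigma y)) (tw_pi z) X).1 = X.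
  apply: etrans e1 _.
  have dI := chart_expr_differentiable (@smooth_map_id _ _ N)
    (chart_at_atlas (tw_pi z)) (chart_at_atlas (tw_pi z))
    (chart_at_dom (tw_pi z)) (chart_at_dom (tw_pi z)).
  apply: etrans (esym (jacE X dI)) _.
  by have := chart_jac_id (chart_at_atlas (tw_pi z)) (chart_at_dom (tw_pi z));
    rewrite /chart_jac => ->; rewrite mul1mx.
rewrite e1; apply: etrans e2 _.
by move: nab; rewrite nabla_endE => /eqP; rewrite addr_eq0 => /eqP.
Qed.

End Twistor.

Section Main.
Variables (R : realType) (d n : nat) (M : manifold R d) (g : riemannian M)
  (J : almost_hermitian g) (N : manifold R n.*2) (h : riemannian N)
  (o : orientation N) (psi : M -> twistor h o).
Hypothesis hpsi : J2_holomorphic J psi.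

Let phi (p : M) : N := tw_pi (psi p).
Let S (p : M) : 'M[R]_(n.*2) := tw_J (psi p).

Lemma proj_smooth : smooth_map phi.
Proof.
have [[cphi sphi] _] := hpsi.
have cphi' : continuous phi by move=> p; exact: cphi.
split=> // c c' ac ac' k.
have op : open (c @` (cdom c `&` phi @^-1` cdom c')).
  apply: chart_img_open; apply: open_comp; last exact: cdom_open.
  by move=> p _; exact: cphi'.
have := sphi c c' ac ac' k; rewrite setTI => C.
apply: (Ck_linear (L := fst) op _ _ C); first by [].
by move=> z; exact: cvg_fst.
Qed.

Definition loc_structure (p : M) (x : 'cV[R]_d) : 'M[R]_(n.*2) :=
  (end_chart (chart_at (phi p)) (tw_end (psi (cinv (chart_at p) x)))).2.

(** The covariant derivative of S along phi in the direction X, that is the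
pull-back of the connection on endomorphisms. *)
Definition nabla_structure (p : M) (X : 'cV[R]_d) : 'M[R]_(n.*2) :=
  'D_X (loc_structure p) (origin p)
  + (christoffel_mx h (phi p) (dmap phi p *m X) *m S p
     - S p *m christoffel_mx h (phi p) (dmap phi p *m X)).

Lemma loc_structure_differentiable p :
  differentiable (loc_structure p) (origin p).
Proof.
have dP := smooth_to_end_differentiable hpsi.1 (I : setT p).
have csnd : continuous (@snd 'cV[R]_(n.*2) 'M[R]_(n.*2)).
  by move=> z; exact: cvg_snd.
have [ds _] := linear_is_diff
  (end_chart (chart_at (phi p)) (tw_end (psi (cinv (chart_at p) (origin p)))))
  (fun _ _ _ => erefl) csnd.
exact: (differentiable_comp dP ds).
Qed.

Lemma tw_end_tangent p X :
  dmap_end (fun q => tw_end (psi q)) p X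
  = (dmap phi p *m X, 'D_X (loc_structure p) (origin p)).
Proof.
have e1 := dmap_end1 hpsi.1 X (I : setT p).
have e2 := dmap_end2 hpsi.1 X (I : setT p).
have dF := chart_expr_differentiable proj_smooth (chart_at_atlas p)
  (chart_at_atlas (phi p)) (chart_at_dom p) (chart_at_dom (phi p)).
move: e1 e2; case: (dmap_end _ _ _) => w1 w2 /= -> ->; congr (_, _).
exact: (esym (jacE X dF)).
Qed.

(** Compare base and fibre components in the splitting of the differential of
psi into a horizontal vector a and a vertical vector b. The base component of a
is dphi X; subtracting the fibre component of a, known from [horizontal_fibre],
leaves b equal to the covariant derivative of S. The minus sign on the vertical
part of the almost complex structure is the one in the second relation. *)
Lemma tw_structure p X :
  [/\ dmap phi p *m (J p *m X) = S p *m (dmap phi p *m X),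
      nabla_structure p (J p *m X) = - (S p *m nabla_structure p X) &
      nabla_structure p X *m S p = - (S p *m nabla_structure p X)].
Proof.
have [a [a' [b [b' []]]]] := hpsi.2 p X.
rewrite !tw_end_tangent => -[ha ha' aa'] [[b1 _ b2] [b1' _ _] bb'] eX eJX.
have := congr1 fst eX; rewrite /= b1 addr0 => ea1.
have := congr1 snd eX; rewrite /= (horizontal_fibre ha) => ea2.
have := congr1 fst eJX; rewrite /= b1' subr0 => ea1'.
have := congr1 snd eJX; rewrite /= (horizontal_fibre ha') => ea2'.
have K : nabla_structure p X = b.2.
  by rewrite /nabla_structure ea2 ea1 /phi /S addrAC addNr add0r.
have K' : nabla_structure p (J p *m X) = - b'.2.
  by rewrite /nabla_structure ea2' ea1' /phi /S addrAC addNr add0r.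
rewrite ea1' aa' -ea1 K K' bb' b2; split => //.
Qed.

(** The relation S dphi = dphi J in the charts at p and phi p, on a
neighbourhood, so that it can be differentiated. *)
Lemma loc_structure_holomorphic p (Y : 'cV[R]_d) : \forall x \near origin p,
  loc_structure p x *m (jac (loc_map phi p) x *m Y)
  = jac (loc_map phi p) x *m (loc_end J (chart_at p) x *m Y).
Proof.
apply: (near_jac_loc_map proj_smooth) => q cq c'q -> _.
rewrite loc_endE// /loc_structure cfunK//= -/(phi q) -/(S q).
have SL (v : 'cV[R]_d) : S q *m (dmap phi q *m v) = dmap phi q *m (J q *m v).
  by have [-> _ _] := tw_structure q v.
move: (frame_fromK (chart_at_atlas p) cq).
move: (frame_fromK (chart_at_atlas (phi p)) c'q).
move: (frame_to _ q) (frame_from _ q).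
move: (frame_to _ (phi q)) (frame_from _ (phi q)).
move=> T' F' T F FT' FT.
rewrite -!mulmxA [F' *m (T' *m _)]mulmxA FT' mul1mx.
by rewrite [F *m (T *m _)]mulmxA FT mul1mx SL.
Qed.

Lemma loc_structure_self p : loc_structure p (origin p) = S p.
Proof.
rewrite /loc_structure cfunK; last exact: chart_at_dom.
by rewrite /= frame_to_self frame_from_self mul1mx mulmx1.
Qed.

Lemma jac_loc_map_self p : jac (loc_map phi p) (origin p) = dmap phi p.
Proof. by []. Qed.

(** The covariant derivative of S dphi = dphi J. *)
Lemma second_form_acs p (X Y : 'cV[R]_d) :
  second_form g h phi p X (J p *m Y)
    + dmap phi p *m (nabla_end g p X J *m Y)
  = nabla_structure p X *m (dmap phi p *m Y) + S p *m second_form g h phi p X Y.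
Proof.
have [dj jE] := jac_loc_map_differentiable proj_smooth p.
have dS := loc_structure_differentiable p.
have dI := loc_acs_differentiable J p.
have djY : differentiable (fun x => jac (loc_map phi p) x *m Y) (origin p).
  by apply: mulmx_differentiable => //; exact: differentiable_cst.
have dIY : differentiable (fun x => loc_end J (chart_at p) x *m Y) (origin p).
  by apply: mulmx_differentiable => //; exact: differentiable_cst.
have e1 := derive_mulmx X dS djY.
have e2 := derive_mulmx X dj dIY.
have e := etrans (esym e1)
  (etrans (near_eq_derive X (loc_structure_holomorphic p Y)) e2).
move: e; rewrite (derive_mulmxr Y X dj) (derive_mulmxr Y X dI) !jE.
rewrite loc_structure_self loc_end_self jac_loc_map_self => e.
rewrite !(second_formE g h proj_smooth) nabla_endE /nabla_structure.
have SL (v : 'cV[R]_d) : S p *m (dmap phi p *m v) = dmap phi p *m (J p *m v).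
  by have [-> _ _] := tw_structure p v.
exact: leibniz_with_connections e SL.
Qed.

(** Adding [second_form_acs] for X, Y and for J X, J Y equates an expression
antisymmetric in X and Y with a symmetric one, so both vanish. *)
Lemma second_form_11 p (X Y : 'cV[R]_d) : symplectic12 J ->
  second_form g h phi p X Y + second_form g h phi p (J p *m X) (J p *m Y) = 0.
Proof.
move=> hM.
have JJ (v : 'cV[R]_d) : J p *m (J p *m v) = - v.
  by rewrite mulmxA acs_sqr mulNmx mul1mx.
have SS (v : 'cV[R]_(n.*2)) : S p *m (S p *m v) = - v.
  by rewrite mulmxA (tw_sqr (tw_prop (psi p))) mulNmx mul1mx.
have key X' Y' : second_form g h phi p X' (J p *m Y')
    - second_form g h phi p (J p *m X') Y'
  = S p *m (second_form g h phi p X' Y'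
            + second_form g h phi p (J p *m X') (J p *m Y')).
  have e1 := second_form_acs p X' Y'.
  have e2 := second_form_acs p (J p *m X') (J p *m Y').
  have [_ KJ KS] := tw_structure p X'.
  have [SL _ _] := tw_structure p Y'.
  have eD : nabla_end g p (J p *m X') J *m (J p *m Y')
      = - (nabla_end g p X' J *m Y').
    rewrite (symplectic12_nabla_acs _ _ hM) mulNmx -mulmxA.
    rewrite [nabla_end g p X' J *m (J p *m _)]mulmxA (nabla_acs_anti J).
    by rewrite mulNmx mulmxN -mulmxA JJ opprK.
  have eK : nabla_structure p (J p *m X') *m (dmap phi p *m (J p *m Y'))
      = - (nabla_structure p X' *m (dmap phi p *m Y')).
    rewrite KJ SL mulNmx -mulmxA.
    rewrite [nabla_structure p X' *m (S p *m _)]mulmxA KS mulNmx mulmxN.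
    by rewrite -mulmxA SS opprK.
  move: e2; rewrite JJ (second_formN g h proj_smooth) eD eK mulmxN => e2.
  have add_eqs (a b x y s1 s2 : 'cV[R]_(n.*2)) :
      a + x = y + s1 -> - b - x = - y + s2 -> a - b = s1 + s2.
    move=> E1 E2; have := congr2 +%R E1 E2.
    by rewrite addrACA subrr addr0 addrACA subrr add0r.
  rewrite mulmxDr; exact: add_eqs e1 e2.
(* With c = u + v, the two equations give S c = - S c, and S is invertible. *)
have alt_sym (a b a' b' u v u' v' : 'cV[R]_(n.*2)) :
    b' = b -> a' = a -> u' = u -> v' = v ->
    a - b = S p *m (u + v) -> b' - a' = S p *m (u' + v') -> u + v = 0.
  move=> -> -> -> ->; rewrite -[b - a]opprB => ->; move: (u + v) => c.
  move=> /eqP; rewrite eq_sym -addr_eq0 -mulr2n -scaler_nat.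
  rewrite scaler_eq0 pnatr_eq0/=.
  by move=> /eqP Sc; apply: oppr_inj; rewrite -SS Sc mulmx0 oppr0.
have sym := second_form_sym g h proj_smooth p.
exact: alt_sym (sym _ _) (sym _ _) (sym _ _) (sym _ _) (key X Y) (key Y X).
Qed.

(** With U and V the images of X and Y, both i-eigenvectors of S, orthogonality
of S gives (U, V) = (S U, S V) = i^2 (U, V) = - (U, V). *)
Lemma dmap_isotropic p (X Y : 'cV[R[i]]_d) : T10 J p X -> T10 J p Y ->
  cinner h (phi p) (cmx (dmap phi p) *m X) (cmx (dmap phi p) *m Y) = 0.
Proof.
move=> XT YT.
have SL : S p *m dmap phi p = dmap phi p *m J p.
  apply: mulmx_inj_cV => v; rewrite -!mulmxA.
  by have [-> _ _] := tw_structure p v.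
have ShS : (S p)^T *m h (phi p) *m S p = h (phi p).
  apply: bilinear_form_eq => u v.
  have := tw_orth (tw_prop (psi p)) u v.
  by rewrite /inner trmx_mul !mulmxA.
have T (Z : 'cV[R[i]]_d) : T10 J p Z ->
    cmx (S p) *m (cmx (dmap phi p) *m Z) = 'i%C *: (cmx (dmap phi p) *m Z).
  move=> ZT; rewrite mulmxA -cmxM SL cmxM -mulmxA.
  by rewrite scalemxAr; congr (_ *m _); exact: ZT.
have := T _ XT; have := T _ YT; move: (_ *m Y) (_ *m X) => V U SV SU.
have e : cinner h (phi p) U V = - cinner h (phi p) U V.
  rewrite {1}/cinner -{1}ShS !cmxM cmx_tr.
  rewrite !mulmxA -trmx_mul -!mulmxA SU SV linearZ/= -!scalemxAl -!scalemxAr.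
  rewrite scalerA -expr2 sqr_i scaleN1r mxE; congr (- _).
  by rewrite /cinner mulmxA.
apply/eqP; move/eqP: e.
by rewrite -addr_eq0 -mulr2n mulrn_eq0.
Qed.

End Main.

Theorem mainTheorem3 (R : realType) (m n : nat)
    (M : manifold R m.*2) (g : riemannian M) (JM : almost_hermitian g)
    (hM : symplectic12 JM)
    (N : manifold R n.*2) (h : riemannian N) (o : orientation N)
    (psi : M -> twistor h o) (hpsi : J2_holomorphic JM psi) :
  let phi : M -> N := fun p => tw_pi (psi p) in
  weakly_pluriconformal JM h phi /\ geodesic11 JM h phi.
Proof.
move=> phi; have sphi : smooth_map phi := proj_smooth hpsi.
split; split=> //; first exact: dmap_isotropic.
move=> p Y Z /T10P[Y1 Y2] /T01P[Z1 Z2].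
(* With Y = a + i b and Z = u + i v, where J b = a, J u = v and J v = - u, these
   are the real and imaginary parts of B (Y, Z). *)
have k1 := second_form_11 hpsi p (immx Y) (- immx Z) hM.
have k2 := second_form_11 hpsi p (immx Y) (remx Z) hM.
move: k1 k2; rewrite mulmxN Y2 Z1 Z2 opprK (second_formN g h sphi) => k1 k2.
have cplx0 (a b c e : 'cV[R]_(n.*2)) : - b + a = 0 -> e + c = 0 ->
    cmx (a - b) + 'i%C *: cmx (c + e) = 0.
  move=> ab ce; rewrite [a - b]addrC [c + e]addrC ab ce.
  by rewrite /cmx !map_mx0 scaler0 addr0.
exact: cplx0 k1 k2.
Qed.
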